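(* (1) Any simple module in $\mathscr{J}(\mathfrak{k},A)$, as well as any simple module in $\mathscr{J}(\mathfrak{k}^+,A)$, is isomorphic to the module $\Gamma(\lambda,b)=A$ for some $\lambda,b\in\mathbb{C}$ with actions: for all $n,k\in\mathbb{Z}$, \begin{align*} x\cdot y&=xy \quad \text{for all } x,y\in A,\\ L_n\cdot t^k&=(\lambda+k+b(n+1))\,t^{n+k},\\ L_n\cdot t^k\xi&=\bigl(\lambda+k+(n+1)(b+\tfrac12)\bigr)t^{n+k}\xi,\\ G_{n+\frac12}\cdot t^k&=-(k+\lambda+2b(n+1))\,t^{n+k}\xi,\\ G_{n+\frac12}\cdot t^k\xi&=-t^{n+k+1} \end{align*} (for the algebra $\mathfrak{k}^+$ one takes the same formulas for those $L_n$, $G_{n+\frac12}$ lying in $\mathfrak{k}^+$, i.e. $n\ge-1$). (2) Any simple module in $\mathscr{J}(\mathfrak{k}^+,A^+)$ is isomorphic to one of the following: (a) $\Gamma(\lambda,b)$ for some $\lambda\in\mathbb{C}\setminus\mathbb{Z}$ and $b\in\mathbb{C}$; (b) the $A^+\mathfrak{k}^+$ submodule $\Gamma^+(0,b):=A^+$ of $\Gamma(0,b)$ for some $b\in\mathbb{C}$; (c) the $A^+\mathfrak{k}^+$ quotient module $\Gamma^-(0,b):=\Gamma(0,b)/\Gamma^+(0,b)$ for some $b\in\mathbb{C}$.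
   Context: Everything is over $\mathbb{C}$; submodules of modules over Lie superalgebras are subsupermodules. $\mathfrak{k}$ is the Lie superalgebra with basis $L_n$ (even, $n\in\mathbb{Z}$), $G_r$ (odd, $r\in\mathbb{Z}+\frac12$) and brackets $[L_m,L_n]=(n-m)L_{m+n}$, $[L_m,G_r]=(r-\frac m2)G_{m+r}$, $[G_r,G_s]=-2L_{r+s}$. $\mathfrak{k}^+$ is the subalgebra spanned by $L_n$ ($n\ge-1$) and $G_r$ ($r\ge-\frac12$). $A=\mathbb{C}[t,t^{-1}]\otimes\Lambda(1)$, where $\Lambda(1)$ is the Grassmann algebra in one variable $\xi$, and $A^+=\mathbb{C}[t]\otimes\Lambda(1)$; these are $\mathbb{Z}_2$-graded with $t$ even and $\xi$ odd. $\mathfrak{k}$ acts on $A$ by $L_i\circ x=t^{i+1}\partial_t(x)+\frac12(i+1)t^i\xi\partial_\xi(x)$ and $G_m\circ x=t^{m+\frac12}\xi\partial_t(x)-t^{m+\frac12}\partial_\xi(x)$; $\mathfrak{k}^+$ preserves $A^+$. With $A$, $A^+$ regarded as abelian Lie superalgebras and $[v,a]=v\circ a$, put $\tilde{\mathfrak{k}}=\mathfrak{k}\ltimes A$, $\tilde{\mathfrak{k}}^+=\mathfrak{k}^+\ltimes A$, $\tilde{\mathfrak{k}}^{++}=\mathfrak{k}^+\ltimes A^+$. An $A\mathfrak{k}$ (resp. $A\mathfrak{k}^+$, $A^+\mathfrak{k}^+$) module is a $\tilde{\mathfrak{k}}$ (resp. $\tilde{\mathfrak{k}}^+$, $\tilde{\mathfrak{k}}^{++}$)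 module on which $A$ (resp. $A$, $A^+$) acts associatively, with $t^0$ acting as the identity. A weight module $M$ is one on which $L_0$ is diagonalizable; $M_\lambda=\{v\in M: L_0v=\lambda v\}$ and $\mathrm{Supp}(M)=\{\lambda\in\mathbb{C}: M_\lambda\ne0\}$. For $(\mathfrak{g},\mathcal{A})\in\{(\mathfrak{k},A),(\mathfrak{k}^+,A),(\mathfrak{k}^+,A^+)\}$, a jet $\mathfrak{g}$ module associated to $\mathcal{A}$ is a weight $\mathcal{A}\mathfrak{g}$ module with a finite-dimensional weight space (i.e. $\dim M_\lambda<\infty$ for some $\lambda\in\mathrm{Supp}(M)$), and $\mathscr{J}(\mathfrak{g},\mathcal{A})$ denotes the category of all such modules.
   Formalization: The formula for G_{n+1/2}·t^k is taken with a plus sign, +(k+λ+2b(n+1))t^{n+k}ξ, since with the printed minus sign Γ(λ,b) violates [G_r,G_s]=-2L_{r+s} and is not a module; ''isomorphic'' allows even or odd isomorphisms, i.e. up to parity change. *)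

(* Defs.v *)
From HB Require Import structures.
From mathcomp Require Import all_boot all_order all_algebra.
From mathcomp Require Import boolp finmap monalg.

Set Implicit Arguments.
Unset Strict Implicit.
Unset Printing Implicit Defensive.

Import GRing.Theory Num.Theory.
Local Open Scope ring_scope.
Local Open Scope quotient_scope.

(* {malg F[K]} is used only as the F-vector space with basis (<< k >>), k : K;
   lext and bilext are the (bi)linear extensions of maps given on the basis. *)
Section FreeModule.
Variables (F : fieldType) (K : choiceType).

Definition lext (V : lmodType F) (f : K -> V) (x : {malg F[K]}) : V :=
  \sum_(i <- msupp x) x@_i *: f i.

(* d i is the parity of the basis vector << i >>. *)
Definition homog (d : K -> bool) (p : bool) : {pred {malg F[K]}} :=
  fun x => all (fun i => d i == p) (msupp x).

Definition homog_part (d : K -> bool) (p : bool) : {malg F[K]} -> {malg F[K]} :=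
  lext (fun i => if d i == p then << i >> else 0).

Definition supported (P : pred K) : {pred {malg F[K]}} :=
  fun x => all P (msupp x).

Lemma supportedP (P : pred K) (x : {malg F[K]}) :
  reflect (forall i, ~~ P i -> x@_i = 0) (x \in supported P).
Proof.
apply: (iffP allP) => [h i nPi | h i].
  by apply: mcoeff_outdom; apply/negP => /h; apply/negP.
by rewrite -mcoeff_neq0; apply: contra_neqT => /h.
Qed.

Fact supported_submod (P : pred K) : submod_closed (supported P).
Proof.
split=> [|c x y /supportedP hx /supportedP hy].
  by apply/supportedP => i _; rewrite mcoeff0.
apply/supportedP => i nPi.
by rewrite mcoeffD mcoeffZ hx // hy // mulr0 addr0.
Qed.

HB.instance Definition _ (P : pred K) :=
  GRing.isSubmodClosed.Build F {malg F[K]} (supported P) (supported_submod P).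

End FreeModule.

Definition bilext (F : fieldType) (K K' : choiceType) (V : lmodType F)
    (f : K -> K' -> V) (x : {malg F[K]}) (y : {malg F[K']}) : V :=
  lext (fun i => lext (f i) y) x.

(* A = F[t, t^-1] (x) Lambda(1): << (k, e) >> is t^k xi^e. *)
Notation laurent F := {malg F[(int * bool)%type]}.

(* k: << (false, n) >> is L_n and << (true, n) >> is G_(n + 1/2). *)
Notation kalg F := {malg F[(bool * int)%type]}.

Notation ktilde F := (kalg F * laurent F)%type.

Section Algebras.
Variable F : numFieldType.
Local Notation laurent := (laurent F).
Local Notation kalg := (kalg F).
Local Notation ktilde := (ktilde F).

Definition tpow (k : int) : laurent := << (k, false) >>.
Definition xi : laurent := << (0, true) >>.

Definition lmul : laurent -> laurent -> laurent :=
  bilext (fun x y : int * bool =>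
    if x.2 && y.2 then 0 else << (x.1 + y.1, x.2 || y.2) >>).

Definition dt : laurent -> laurent :=
  lext (fun x : int * bool => x.1%:~R *: << (x.1 - 1, x.2) >>).

Definition dxi : laurent -> laurent :=
  lext (fun x : int * bool => if x.2 then << (x.1, false) >> else 0).

Definition kL (n : int) : kalg := << (false, n) >>.
Definition kG (n : int) : kalg := << (true, n) >>.

Definition kbracket : kalg -> kalg -> kalg :=
  bilext (fun x y : bool * int =>
    let m := x.2 in let n := y.2 in
    match x.1, y.1 with
    | false, false => (n - m)%:~R *: kL (m + n)
    | false, true => (n%:~R + 2^-1 - m%:~R / 2) *: kG (m + n)
    | true, false => - (m%:~R + 2^-1 - n%:~R / 2) *: kG (m + n)
    | true, true => (- 2) *: kL (m + n + 1)
    end).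

(* For i = (true, n) this is the action of G_m with m = n + 1/2, so that
   t^(m + 1/2) = t^(n + 1). *)
Definition kact : kalg -> laurent -> laurent := fun u x =>
  lext (fun i : bool * int =>
    let n := i.2 in
    if i.1 then lmul (tpow (n + 1)) (lmul xi (dt x)) - lmul (tpow (n + 1)) (dxi x)
    else lmul (tpow (n + 1)) (dt x)
         + (2^-1 * (n + 1)%:~R) *: lmul (tpow n) (lmul xi (dxi x))) u.

Definition ktilde_homog (p : bool) : {pred ktilde} :=
  fun X => (X.1 \in homog fst p) && (X.2 \in homog snd p).

(* [u + a, v + b] = [u, v] + u o b + [a, v], where A is abelian and, on
   homogeneous elements, [a, v] = - (-1)^(|a| |v|) (v o a). *)
Definition ktilde_bracket (X Y : ktilde) : ktilde :=
  (kbracket X.1 Y.1,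
   kact X.1 Y.2
   - \sum_(p : bool) \sum_(q : bool)
       (-1) ^+ (p && q) *: kact (homog_part fst q Y.1) (homog_part snd p X.2)).

Definition kfull : {pred kalg} := predT.
(* L_n for n >= -1, and G_(n + 1/2) for n + 1/2 >= -1/2. *)
Definition kplus : {pred kalg} :=
  supported (fun i : bool * int => (- 1 <= i.2)%R).

Definition Afull : {pred laurent} := predT.
Definition Aplus : {pred laurent} :=
  supported (fun x : int * bool => (0 <= x.1)%R).

HB.instance Definition _ := GRing.SubmodClosed.on Aplus.

Definition semidirect (g : {pred kalg}) (A : {pred laurent}) : {pred ktilde} :=
  fun X => (X.1 \in g) && (X.2 \in A).

(* A superspace with operators indexed by all of ktilde. In a module over a
   subalgebra S of ktilde only the operators indexed by S are meaningful; the
   notions below never refer to the other ones. *)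
Record superrep := SuperRep {
  carrier :> lmodType F;
  par : bool -> {pred carrier};
  act : ktilde -> carrier -> carrier
}.

Record is_module (S : {pred ktilde}) (M : superrep) : Prop := IsModule {
  par_submod : forall p, submod_closed (@par M p);
  par_decomp : forall v : M, exists v0 v1 : M,
    [/\ v0 \in par false, v1 \in par true & v = v0 + v1];
  par_direct : forall v : M, v \in par false -> v \in par true -> v = 0;
  act_linearl : forall c X Y (v : M), X \in S -> Y \in S ->
    act (c *: X + Y) v = c *: act X v + act Y v;
  act_linearr : forall c X (v w : M), X \in S ->
    act X (c *: v + w) = c *: act X v + act X w;
  act_par : forall p q X (v : M), X \in S -> X \in ktilde_homog p ->
    v \in par q -> act X v \in @par M (p (+) q);
  act_bracket : forall p q X Y (v : M), X \in S -> Y \in S ->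
    X \in ktilde_homog p -> Y \in ktilde_homog q ->
    act (ktilde_bracket X Y) v
    = act X (act Y v) - (-1) ^+ (p && q) *: act Y (act X v)
}.

Record is_submodule (S : {pred ktilde}) (M : superrep) (N : {pred M}) : Prop :=
  IsSubmodule {
  sub_submod : submod_closed N;
  sub_graded : forall v, v \in N -> exists v0 v1 : M,
    [/\ v0 \in N, v1 \in N, v0 \in par false, v1 \in par true & v = v0 + v1];
  sub_act : forall X v, X \in S -> v \in N -> act X v \in N
}.

Definition simple (S : {pred ktilde}) (M : superrep) : Prop :=
  (exists v : M, v != 0) /\
  forall N : {pred M}, is_submodule S N ->
    (forall v, v \in N -> v = 0) \/ (forall v, v \in N).

Definition is_Ag_module (g : {pred kalg}) (A : {pred laurent}) (M : superrep) :
    Prop :=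
  [/\ is_module (semidirect g A) M,
      forall a b (v : M), a \in A -> b \in A ->
        act (0, lmul a b) v = act (0, a) (act (0, b) v)
    & forall v : M, act (0, tpow 0) v = v].

Definition weight_space (M : superrep) (lam : F) (v : M) : Prop :=
  act (kL 0, 0) v = lam *: v.

Definition in_supp (M : superrep) (lam : F) : Prop :=
  exists2 v : M, v != 0 & weight_space lam v.

(* L_0 is diagonalizable: M is spanned by its weight vectors. *)
Definition is_weight (M : superrep) : Prop :=
  forall v : M, exists2 s : seq M,
    {in s, forall w, exists lam, weight_space lam w} & v = \sum_(w <- s) w.

Definition weight_space_findim (M : superrep) (lam : F) : Prop :=
  exists n (e : 'I_n -> M), (forall i, weight_space lam (e i)) /\
    forall v, weight_space lam v -> exists c : 'I_n -> F, v = \sum_i c i *: e i.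

Definition is_jet (g : {pred kalg}) (A : {pred laurent}) (M : superrep) : Prop :=
  [/\ is_Ag_module g A M, is_weight M
    & exists2 lam, in_supp M lam & weight_space_findim M lam].

(* Even (p = false) or odd (p = true) isomorphisms, i.e. even isomorphisms onto
   N or onto its parity shift. *)
Definition isomorphic (S : {pred ktilde}) (M N : superrep) : Prop :=
  exists (p : bool) (f : {linear M -> N}),
    [/\ bijective f,
        forall q v, v \in par q -> f v \in @par N (p (+) q)
      & forall X v, X \in S -> f (act X v) = act X (f v)].

Section Subquotient.
Variables (V : lmodType F) (N : submodClosed V).

Record subspace := Subspace { subspace_val : V; _ : subspace_val \in N }.
HB.instance Definition _ := [isSub for subspace_val].
HB.instance Definition _ := [Choice of subspace by <:].
HB.instance Definition _ := [SubChoice_isSubLmodule of subspace by <:].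

Fact submod_zmod_closed : zmod_closed N.
Proof.
split=> [|x y xN yN]; first exact: rpred0.
by rewrite addrC -scaleN1r rpredD ?rpredZ.
Qed.

Definition zmod_part : zmodClosed V :=
  HB.pack (GRing.SubmodClosed.sort N)
    (GRing.isZmodClosed.Build V (GRing.SubmodClosed.sort N) submod_zmod_closed).

Definition quotient := Quotient.quot zmod_part.
HB.instance Definition _ := Choice.on quotient.
HB.instance Definition _ := EqQuotient.on quotient.
HB.instance Definition _ := GRing.Zmodule.on quotient.
HB.instance Definition _ := ZmodQuotient.on quotient.

Local Notation pi := (\pi_quotient : V -> quotient).

Definition quotient_scale (c : F) (x : quotient) : quotient := pi (c *: repr x).

Fact pi_scale c (v : V) : quotient_scale c (pi v) = pi (c *: v).
Proof.
apply/eqP; rewrite /quotient_scale -Quotient.idealrBE -scalerBr.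
have : (repr (pi v) - v \in zmod_part) = true.
  by rewrite Quotient.idealrBE reprK eqxx.
exact: (@rpredZ F V N c (repr (pi v) - v)).
Qed.

Fact quotient_scaleA c d x :
  quotient_scale c (quotient_scale d x) = quotient_scale (c * d) x.
Proof. by rewrite -[x]reprK (pi_scale d) (pi_scale c) (pi_scale (c * d)) scalerA. Qed.

Fact quotient_scale1 x : quotient_scale 1 x = x.
Proof. by rewrite -[x]reprK pi_scale scale1r. Qed.

Fact quotient_scaleDr c x y :
  quotient_scale c (x + y) = quotient_scale c x + quotient_scale c y.
Proof.
rewrite -[x]reprK -[y]reprK -(raddfD (\pi_quotient)) !pi_scale.
by rewrite scalerDr raddfD.
Qed.

Fact quotient_scaleDl x c d :
  quotient_scale (c + d) x = quotient_scale c x + quotient_scale d x.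
Proof. by rewrite -[x]reprK !pi_scale scalerDl raddfD. Qed.

HB.instance Definition _ := GRing.Zmodule_isLmodule.Build F quotient
  quotient_scaleA quotient_scale1 quotient_scaleDr quotient_scaleDl.

End Subquotient.

(* The default 0 is reached only for operators that do not preserve N. *)
Definition subrep (M : superrep) (N : submodClosed M) : superrep :=
  @SuperRep (subspace N)
    (fun p v => val v \in par p)
    (fun X v => insubd 0 (act X (val v))).

(* The action on classes does not depend on the representatives for the
   operators that preserve N. *)
Definition quotrep (M : superrep) (N : submodClosed M) : superrep :=
  @SuperRep (quotient N)
    (fun p v => `[< exists2 w : M, w \in par p & v = \pi_(quotient N) w >])
    (fun X v => \pi_(quotient N) (act X (repr v))).

Section Gamma.
Variables lam b : F.

(* The coefficient of G_(n + 1/2) . t^k has a plus sign: acting on t^k,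
   [G_(n + 1/2), t^j] = G_(n + 1/2) o t^j = j t^(n + j) xi requires
   c (k + j) - c k = j when G_(n + 1/2) . t^k = c k t^(n + k) xi, and together
   with G_(n + 1/2) . t^k xi = - t^(n + k + 1) it gives
   [G_r, G_s] = - 2 L_(r + s); the opposite sign violates both relations. *)
Definition Gamma_basis_act (i : bool * int) (x : int * bool) : laurent :=
  let n := i.2 in let k := x.1 in
  match i.1, x.2 with
  | false, false => (lam + k%:~R + b * (n + 1)%:~R) *: << (n + k, false) >>
  | false, true =>
      (lam + k%:~R + (n + 1)%:~R * (b + 2^-1)) *: << (n + k, true) >>
  | true, false => (k%:~R + lam + 2 * b * (n + 1)%:~R) *: << (n + k, true) >>
  | true, true => - << (n + k + 1, false) >>
  end.

Definition Gamma_act (X : ktilde) (y : laurent) : laurent :=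
  bilext Gamma_basis_act X.1 y + lmul X.2 y.

Definition Gamma : superrep := @SuperRep laurent (homog snd) Gamma_act.

End Gamma.

Definition Gamma_plus (b : F) : superrep := @subrep (Gamma 0 b) Aplus.
Definition Gamma_minus (b : F) : superrep := @quotrep (Gamma 0 b) Aplus.

End Algebras.

Arguments kfull {F}.
Arguments kplus {F}.
Arguments Afull {F}.
Arguments Aplus {F}.

(* Main.v *)
From HB Require Import structures.
Require Import Defs.
From mathcomp Require Import all_boot all_order all_algebra.
From mathcomp Require Import reals complex boolp monalg finmap.
From mathcomp Require Import zify ring lra.

(** Write [G] for [G_(-1/2)] and, on a module, put

      dxi = xi L_(-1) - G,                 h  = L_0 - t L_(-1),
      E1  = L_1 - 2 t L_0 + t^2 L_(-1),    E2 = L_2 - 3 t L_1 + 3 t^2 L_0 - t^3 L_(-1).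

    On the fibre of the module at a point [s] of the line, [E1] and [E2] are the
    fields [(t - s)^(k + 1) d/dt], [k = 1, 2], and [h] is the Euler field
    [(t - s) d/dt]. All of them commute with [t] and [L_(-1)]; [xi] and [dxi]
    generate a Clifford algebra; [xi], [dxi], [E1] and [E2] move the
    eigenvalues of [h] by [1/2], [- 1/2], [1] and [2].

    Let [v] be an eigenvector of [h], of weight in [lam0 + Z/2] where the weight
    space of [lam0] is finite dimensional, whose eigenvalue [beta] is maximal in
    [beta + N/2]. Then [xi v = 0], so [u = dxi v] is not zero, and
    [dxi u = E1 u = E2 u = 0]. These equations say that [G], [L_(-1)], ..., [L_2]
    act on [u] as they do on the element [t^0] of [Gamma (lam, b)], with
    [b = beta - 1/2] ([density_vector_exists]). The other [L_n], [n >= -1], are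
    iterated brackets of these and [G_r] is a multiple of a bracket of some [L_n]
    with [G], so the map [t^k xi^e |-> xi^e t^k u] is equivariant
    ([family_map_act]). Distinct basis elements have distinct weights, hence it
    is injective, and its image is a submodule, hence everything.

    The maximal eigenvalue exists because the eigenvalues of [h] on the weight
    space of [lam0] are finite in number and all others are compared with them
    by shifting the weight. When [t] is invertible, powers of [t] do this
    ([h_bounded_invertible]). Over [A^+] one uses powers of [L_(-1)] and of [t],
    and the shift can stop at a vector annihilated by one of them; a vector
    annihilated by [L_(-1)] leads to a vector annihilated by [G], which generates
    a submodule bounded below in weight ([lowest_weight]), so simplicity bounds
    the eigenvalue also then ([plus_h_bounded]).

    For [k] itself one more generator, [L_(-2)], is needed. With
    [D = L_1 - 3 t L_0 + 3 t^2 L_(-1) - t^3 L_(-2)] and [H = L_1 - t L_0], which is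
    [E1 + t h], the vectors [(t^(-1) E1)^i t^(-1) D u] are eigenvectors of
    [t^(-1) H] with eigenvalues [b + 2 + i] in one finite dimensional weight
    space. If [D u] were not zero, the last one that is not zero would be
    annihilated by [E1] and so be an eigenvector of [h] above the maximum
    ([Lmm_density]).

    Over [A^+] the operators [t] and [L_(-1)] generate a Weyl algebra in which
    [t L_(-1)] has eigenvalue [lam] on [u]. If [lam] is not an integer, the string
    [t^k u], [L_(-1)^k u] never breaks and [Gamma (lam, b)] results. Otherwise one
    moves along the string to a vector annihilated by [L_(-1)], which generates
    [Gamma^+ (0, b)], or to a vector annihilated by [t], which generates
    [Gamma^- (0, b)] ([density_integral_exponent]). *)
Set Implicit Arguments.
Unset Strict Implicit.
Unset Printing Implicit Defensive.

Import Order.TTheory GRing.Theory Num.Theory.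
Local Open Scope ring_scope.
Local Open Scope quotient_scope.

(** * Deciding linear identities in a vector space *)

Section LinearCombinations.
Variables (F : fieldType) (V : lmodType F).

(** Reified linear combinations; [LVar i] stands for the [i]-th entry of an
    environment of vectors. *)
Inductive lexpr :=
  LVar of nat | LZero | LAdd of lexpr & lexpr | LOpp of lexpr | LScale of F & lexpr.

Fixpoint leval (env : seq V) (e : lexpr) : V :=
  match e with
  | LVar i => nth 0 env i
  | LZero => 0
  | LAdd e1 e2 => leval env e1 + leval env e2
  | LOpp e1 => - leval env e1
  | LScale c e1 => c *: leval env e1
  end.

Fixpoint lcoef (e : lexpr) (i : nat) : F :=
  match e with
  | LVar j => if Nat.eqb i j then 1 else 0
  | LZero => 0
  | LAdd e1 e2 => lcoef e1 i + lcoef e2 i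
  | LOpp e1 => - lcoef e1 i
  | LScale c e1 => c * lcoef e1 i
  end.

Fixpoint same_coefs (e1 e2 : lexpr) (s : seq nat) : Prop :=
  if s is i :: s' then lcoef e1 i = lcoef e2 i /\ same_coefs e1 e2 s' else True.

Lemma leval_coef env e :
  leval env e = \sum_(i < size env) lcoef e i *: nth 0 env i.
Proof.
elim: e => [j||e1 IH1 e2 IH2|e IH|c e IH] /=.
- have [lt_j|le_j] := ltnP j (size env).
    rewrite (bigD1 (Ordinal lt_j)) //= PeanoNat.Nat.eqb_refl scale1r big1 ?addr0 //.
    move=> i; rewrite -val_eqE /= => neq_ij; case: PeanoNat.Nat.eqb_spec => [eq_ij|].
      by rewrite eq_ij eqxx in neq_ij.
    by rewrite scale0r.
  rewrite nth_default // big1 // => i _; case: PeanoNat.Nat.eqb_spec => [eq_ij|].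
    by rewrite -eq_ij leqNgt ltn_ord in le_j.
  by rewrite scale0r.
- by rewrite big1 // => i _; rewrite scale0r.
- by rewrite IH1 IH2 -big_split; apply: eq_bigr => i _; rewrite scalerDl.
- by rewrite IH -sumrN; apply: eq_bigr => i _; rewrite scaleNr.
- by rewrite IH scaler_sumr; apply: eq_bigr => i _; rewrite scalerA.
Qed.

Lemma same_coefsP env e1 e2 :
  same_coefs e1 e2 (iota 0 (size env)) -> leval env e1 = leval env e2.
Proof.
move=> same; rewrite !leval_coef; apply: eq_bigr => i _; congr (_ *: _).
have: (i : nat) \in iota 0 (size env) by rewrite mem_iota ltn_ord.
elim: (iota _ _) same => //= j s IH [eq_j same].
by rewrite inE => /orP[/eqP-> //|]; apply: IH.
Qed.

End LinearCombinations.

(** Atoms are compared up to conversion: the same vector often occurs under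
    different paths through the algebraic hierarchy. *)
Ltac lmod_index x env :=
  match env with
  | ?y :: _ => let _ := match goal with _ => unify x y end in constr:(0%N)
  | _ :: ?env' => let i := lmod_index x env' in constr:(S i)
  end.

Ltac lmod_atoms e env :=
  lazymatch e with
  | (?a + ?b)%R => let env1 := lmod_atoms a env in lmod_atoms b env1
  | (- ?a)%R => lmod_atoms a env
  | (_ *: ?a)%R => lmod_atoms a env
  | 0%R => env
  | _ => match env with
         | _ => let i := lmod_index e env in env
         | _ => constr:(e :: env)
         end
  end.

Ltac lmod_quote F e env :=
  lazymatch e with
  | (?a + ?b)%R => let a' := lmod_quote F a env in
      let b' := lmod_quote F b env in constr:(LAdd a' b')
  | (- ?a)%R => let a' := lmod_quote F a env in constr:(LOpp a')
  | (?c *: ?a)%R => let a' := lmod_quote F a env in constr:(LScale c a')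
  | 0%R => constr:(@LZero F)
  | _ => let i := lmod_index e env in constr:(@LVar F i)
  end.

(** Closes an identity between linear combinations of vectors by comparing
    coefficients, which are left to field arithmetic. *)
Ltac lmod :=
  lazymatch goal with
  | |- @eq ?T ?a ?b =>
    let F := lazymatch goal with
      | F : numFieldType |- _ => constr:(F : fieldType)
      | F : numClosedFieldType |- _ => constr:(F : fieldType)
      end in
    let env := lmod_atoms a (@nil T) in
    let env := lmod_atoms b env in
    let a' := lmod_quote F a env in
    let b' := lmod_quote F b env in
    apply: (@same_coefsP _ _ env a' b');
    cbv [same_coefs iota size lcoef Nat.eqb];
    repeat (split; first by field); exact: I
  end.

(** * Eigenvectors in finitely spanned spaces *)
Definition fin_spanned (F : fieldType) (V : lmodType F) (W : V -> Prop) :=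
  exists n (e : 'I_n -> V),
    (forall i, W (e i)) /\ forall v, W v -> exists c, v = \sum_i c i *: e i.

Section FiniteSpan.
Variables (F : numClosedFieldType) (V : lmodType F).
Implicit Types (W : V -> Prop) (f : {linear V -> V}).

(** Argument order chosen so that folding over a list of scalars [r_i] applies
    the product of the operators [f - r_i]. *)
Definition shift_by f (v : V) (r : F) := f v - r *: v.

(** The matrix of [f] on a finite spanning family, which may be linearly
    dependent, is annihilated by its characteristic polynomial, and this
    splits over a closed field. *)
Lemma fin_spanned_annihilator f W :
    fin_spanned W -> (forall v, W v -> W (f v)) ->
  exists rs : seq F, forall v, W v -> foldl (shift_by f) v rs = 0.
Proof.
(* The characteristic polynomial is evaluated in the ring of square matrices
   of positive size, whence the separate treatment of the empty family. *)
move=> [[|n] [e [We spanW]]] fW.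
  by exists [::] => v /spanW[c ->]; rewrite big_ord0.
have /fin_all_exists[a fe] : forall i, exists a, f (e i) = \sum_j a j *: e j.
  by move=> i; apply/spanW/fW.
pose A : 'M[F]_n.+1 := \matrix_(i, j) a i j.
pose comb (c : 'rV_n.+1) := \sum_j c 0 j *: e j.
have combA c : comb (c *m A) = f (comb c).
  rewrite /comb linear_sum; under [RHS]eq_bigr do rewrite linearZ /= fe scaler_sumr.
  rewrite exchange_big; apply: eq_bigr => j _.
  rewrite mxE scaler_suml; apply: eq_bigr => i _.
  by rewrite mxE scalerA.
have comb_shift c r : comb (c *m (A - r%:M)) = shift_by f (comb c) r.
  rewrite mulmxBr mul_mx_scalar /shift_by -combA /comb scaler_sumr -sumrB.
  by apply: eq_bigr => j _; rewrite !mxE scalerBl scalerA.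
have comb_foldl rs c : foldl (shift_by f) (comb c) rs
    = comb (c *m \prod_(r <- rs) (A - r%:M)).
  elim: rs c => [|r rs IH] c /=; first by rewrite big_nil mulmx1.
  by rewrite big_cons -comb_shift IH mulmxA.
have [rs char_rs] := closed_field_poly_normal (char_poly A).
exists rs => v /spanW[c ->].
have -> : \sum_i c i *: e i = comb (\row_i c i).
  by apply: eq_bigr => i _; rewrite mxE.
rewrite comb_foldl; suff -> : \prod_(r <- rs) (A - r%:M) = 0.
  by rewrite mulmx0 /comb big1 // => j _; rewrite mxE scale0r.
have := Cayley_Hamilton A.
rewrite char_rs (monicP (char_poly_monic A)) scale1r rmorph_prod /= => <-.
by apply: eq_bigr => r _; rewrite rmorphB /= horner_mx_X horner_mx_C.
Qed.

Lemma annihilated_eigenvalue f v (b : F) rs :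
  foldl (shift_by f) v rs = 0 -> v != 0 -> f v = b *: v -> b \in rs.
Proof.
move=> + v0 fv; suff -> : foldl (shift_by f) v rs = (\prod_(r <- rs) (b - r)) *: v.
  move/eqP; rewrite scaler_eq0 (negPf v0) orbF prodf_seq_eq0 => /hasP[r r_rs].
  by rewrite subr_eq0 => /eqP->.
have fcv c : f (c *: v) = b *: (c *: v) by rewrite linearZ /= fv !scalerA mulrC.
have foldl_v c : foldl (shift_by f) (c *: v) rs = (c * \prod_(r <- rs) (b - r)) *: v.
  elim: rs c => [|r rs IH] c /=; first by rewrite big_nil mulr1.
  by rewrite /shift_by fcv -scalerBl scalerA IH big_cons (mulrC _ c) mulrA.
by rewrite -[v in LHS]scale1r foldl_v mul1r.
Qed.

(** In the sequence [v], [(f - r_1) v], [(f - r_2) (f - r_1) v], ..., which ends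
    with [0], the last nonzero term is an eigenvector. *)
Lemma annihilated_eigenvector f W v rs :
    (forall c x y, W x -> W y -> W (c *: x + y)) -> (forall x, W x -> W (f x)) ->
    foldl (shift_by f) v rs = 0 -> v != 0 -> W v ->
  exists x b, [/\ x != 0, W x & f x = b *: x].
Proof.
move=> Wlin fW; elim: rs v => [|r rs IH] v /=; first by move=> ->; rewrite eqxx.
move=> shift_rs v0 Wv; have [shift0|nz] := eqVneq (shift_by f v r) 0.
  by exists v, r; split=> //; apply/eqP; rewrite -subr_eq0 -/(shift_by f v r) shift0.
by apply: (IH _ shift_rs nz); rewrite /shift_by addrC -scaleNr; apply/Wlin/fW.
Qed.

End FiniteSpan.

(** Eigenvectors for eigenvalues other than [b] cannot add up to an
    eigenvector for [b]: applying [f - a], with [a] the eigenvalue of one of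
    the summands, removes that summand and keeps the others eigenvectors. *)
Lemma sum_eigenvectors_eq0 (F : numFieldType) (V : lmodType F) (f : {linear V -> V})
    (b : F) (s : seq V) :
    {in s, forall w, exists2 a, a != b & f w = a *: w} ->
    f (\sum_(w <- s) w) = b *: \sum_(w <- s) w ->
  \sum_(w <- s) w = 0.
Proof.
have [n] := ubnP (size s); elim: n s => // n IH [|w s] /=.
  by rewrite big_nil.
rewrite ltnS => sz_s eig; have [a neq_ab fw] := eig w (mem_head _ _).
set x := \sum_(y <- _) y => fx.
pose shift y := f y - a *: y.
have shiftE y : shift y = f y - a *: y by [].
suff : shift x = 0.
  move/eqP; rewrite shiftE fx -scalerBl scaler_eq0 subr_eq0 eq_sym (negPf neq_ab).
  by move/eqP.
have shift_x : shift x = \sum_(y <- map shift s) y.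
  rewrite big_map shiftE /x big_cons linearD fw scalerDr opprD addrACA subrr add0r.
  by rewrite linear_sum scaler_sumr -sumrB.
rewrite shift_x; apply: IH; first by rewrite size_map.
  move=> _ /mapP[y ys ->]; have [|c neq_cb fy] := eig y; first by rewrite inE ys orbT.
  by exists c; rewrite // shiftE linearB linearZ /= fy linearZ /= fy; lmod.
by rewrite -shift_x shiftE linearB linearZ /= fx linearZ /= fx; lmod.
Qed.

(** * Operators of a contact module *)

Lemma int_even_or_odd (j : int) : exists m : int, j = 2 * m \/ j = 2 * m + 1.
Proof. by exists (j %/ 2)%Z; lia. Qed.

Section HalfSteps.
Variable F : numFieldType.
Implicit Types b c : F.

Lemma half_steps_bounded b (s : seq F) :
  exists B, forall j, b + j%:R / 2 \in s -> (j <= B)%N.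
Proof.
elim: s => [|c s [B leB]]; first by exists 0%N.
have [[j0 eq_j0]|no_j] := pselect (exists j0, b + j0%:R / 2 = c).
  exists (maxn j0 B) => j; rewrite inE leq_max => /orP[/eqP eq_j|/leB->]; last by rewrite orbT.
  suff /eqP: j%:R = j0%:R :> F by rewrite eqr_nat => /eqP->; rewrite leqnn.
  apply: (mulIf (x := 2^-1)); first by rewrite invr_eq0 pnatr_eq0.
  by apply: (addrI b); rewrite eq_j eq_j0.
exists B => j; rewrite inE => /orP[/eqP eq_j|/leB//].
by case: no_j; exists j.
Qed.

(** The equation fixes [i + j]. *)
Lemma half_descent_bounded b c :
  exists B, forall i j, b + j%:R / 2 = c - i%:R / 2 -> (j <= B)%N.
Proof.
have [[i0 [j0 eq0]]|no_ij] :=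
  pselect (exists i0 j0, b + j0%:R / 2 = c - i0%:R / 2); last first.
  by exists 0%N => i j eq_ij; case: no_ij; exists i, j.
exists (j0 + i0)%N => i j eq_ij; suff /eqP: (j + i)%:R = (j0 + i0)%:R :> F.
  by rewrite eqr_nat => /eqP<-; apply: leq_addr.
have two_c n m d : b + m%:R / 2 = d - n%:R / 2 -> (m + n)%:R = 2 * (d - b) :> F.
  move=> eqd; have -> : d = b + m%:R / 2 + n%:R / 2 by rewrite eqd subrK.
  by rewrite natrD; field.
by rewrite (two_c _ _ _ eq_ij) (two_c _ _ _ eq0).
Qed.

End HalfSteps.

(** The operators of an [A^+ k^+] module on which the argument rests, with
    [op_Lm] for [L_(-1)] and [op_G] for [G_(-1/2)]. Each relation is oriented to
    move [op_t] to the left, then [op_xi], [op_Lm], [op_G], [op_L0], [op_L1] and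
    [op_L2], so that rewriting with all of them terminates. *)
Record contact_ops (F : numFieldType) (V : lmodType F) := ContactOps {
  op_t : {linear V -> V};
  op_xi : {linear V -> V};
  op_Lm : {linear V -> V};
  op_L0 : {linear V -> V};
  op_L1 : {linear V -> V};
  op_L2 : {linear V -> V};
  op_G : {linear V -> V};
  op_xi_xi : forall x, op_xi (op_xi x) = 0;
  op_xi_t : forall x, op_xi (op_t x) = op_t (op_xi x);
  op_Lm_t : forall x, op_Lm (op_t x) = op_t (op_Lm x) + x;
  op_L0_t : forall x, op_L0 (op_t x) = op_t (op_L0 x) + op_t x;
  op_L1_t : forall x, op_L1 (op_t x) = op_t (op_L1 x) + op_t (op_t x);
  op_L2_t : forall x, op_L2 (op_t x) = op_t (op_L2 x) + op_t (op_t (op_t x));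
  op_Lm_xi : forall x, op_Lm (op_xi x) = op_xi (op_Lm x);
  op_L0_xi : forall x, op_L0 (op_xi x) = op_xi (op_L0 x) + 2^-1 *: op_xi x;
  op_G_t : forall x, op_G (op_t x) = op_t (op_G x) + op_xi x;
  op_G_xi : forall x, op_G (op_xi x) = - op_xi (op_G x) - x;
  op_G_G : forall x, op_G (op_G x) = - op_Lm x;
  op_G_Lm : forall x, op_G (op_Lm x) = op_Lm (op_G x);
  op_L0_G : forall x, op_L0 (op_G x) = op_G (op_L0 x) - 2^-1 *: op_G x;
  op_L0_Lm : forall x, op_L0 (op_Lm x) = op_Lm (op_L0 x) - op_Lm x;
  op_L1_Lm : forall x, op_L1 (op_Lm x) = op_Lm (op_L1 x) - 2 *: op_L0 x;
  op_L2_Lm : forall x, op_L2 (op_Lm x) = op_Lm (op_L2 x) - 3 *: op_L1 x;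
  op_L1_L0 : forall x, op_L1 (op_L0 x) = op_L0 (op_L1 x) - op_L1 x;
  op_L2_L0 : forall x, op_L2 (op_L0 x) = op_L0 (op_L2 x) - 2 *: op_L2 x
}.

(** Restricted to a given [f]: as a rewrite rule, [linearZ] would also apply to
    scalings themselves and never stop. *)
Lemma linear_rules (F : fieldType) (V : lmodType F) (f : {linear V -> V}) :
  (forall x y, f (x + y) = f x + f y) * (forall x, f (- x) = - f x)
  * (forall c x, f (c *: x) = c *: f x) * (f 0 = 0).
Proof.
by split; [split; [split|]|]; [exact: linearD|exact: linearN|exact: linearZ_LR|exact: linear0].
Qed.

Section ContactTheory.
Variables (F : numFieldType) (V : lmodType F) (C : contact_ops V).
Local Notation t := (op_t C).
Local Notation xi := (op_xi C).
Local Notation Lm := (op_Lm C).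
Local Notation L0 := (op_L0 C).
Local Notation L1 := (op_L1 C).
Local Notation L2 := (op_L2 C).
Local Notation G := (op_G C).
Implicit Types (x u v y : V) (lam b : F).

Let ordered := (op_xi_xi C, op_xi_t C, op_Lm_t C, op_L0_t C, op_L1_t C, op_L2_t C,
  op_Lm_xi C, op_L0_xi C, op_G_t C, op_G_xi C, op_G_G C, op_G_Lm C, op_L0_G C,
  op_L0_Lm C, op_L1_Lm C, op_L2_Lm C, op_L1_L0 C, op_L2_L0 C).
Let lin := (linear_rules t, linear_rules xi, linear_rules Lm, linear_rules L0,
  linear_rules L1, linear_rules L2, linear_rules G).

(** [dxi_op] acts on [Gamma (lam, b)] as the derivative with respect to [xi],
    [h_op] as multiplication by [b] on [t^k] and by [b + 1/2] on [t^k xi], and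
    [E1_op], [E2_op] as zero. *)
Definition dxi_op x := xi (Lm x) - G x.
Definition h_op x := L0 x - t (Lm x).
Definition E1_op x := L1 x - 2 *: t (L0 x) + t (t (Lm x)).
Definition E2_op x := L2 x - 3 *: t (L1 x) + 3 *: t (t (L0 x)) - t (t (t (Lm x))).

Ltac normalize := rewrite /dxi_op /h_op /E1_op /E2_op; rewrite ?(ordered, lin);
  lmod.

Lemma h_op_linear : linear h_op.
Proof. by move=> c x y; normalize. Qed.
HB.instance Definition _ := GRing.isLinear.Build F V V *:%R h_op h_op_linear.
Lemma dxi_op_linear : linear dxi_op.
Proof. by move=> c x y; normalize. Qed.
HB.instance Definition _ := GRing.isLinear.Build F V V *:%R dxi_op dxi_op_linear.

Lemma E1_op_linear : linear E1_op.
Proof. by move=> c x y; normalize. Qed.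
HB.instance Definition _ := GRing.isLinear.Build F V V *:%R E1_op E1_op_linear.
Lemma E2_op_linear : linear E2_op.
Proof. by move=> c x y; normalize. Qed.
HB.instance Definition _ := GRing.isLinear.Build F V V *:%R E2_op E2_op_linear.

Lemma clifford x : dxi_op (xi x) + xi (dxi_op x) = x.
Proof. by normalize. Qed.
Lemma dxi_dxi x : dxi_op (dxi_op x) = 0.
Proof. by normalize. Qed.
Lemma h_xi x : h_op (xi x) = xi (h_op x) + 2^-1 *: xi x.
Proof. by normalize. Qed.
Lemma h_dxi x : h_op (dxi_op x) = dxi_op (h_op x) - 2^-1 *: dxi_op x.
Proof. by normalize. Qed.
Lemma h_t x : h_op (t x) = t (h_op x).
Proof. by normalize. Qed.
Lemma h_Lm x : h_op (Lm x) = Lm (h_op x).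
Proof. by normalize. Qed.
Lemma L0_dxi x : L0 (dxi_op x) = dxi_op (L0 x) - 2^-1 *: dxi_op x.
Proof. by normalize. Qed.
Lemma L0_E1 x : L0 (E1_op x) = E1_op (L0 x) + E1_op x.
Proof. by normalize. Qed.
Lemma L0_E2 x : L0 (E2_op x) = E2_op (L0 x) + 2 *: E2_op x.
Proof. by normalize. Qed.
Lemma E1_t x : E1_op (t x) = t (E1_op x).
Proof. by normalize. Qed.
Lemma E1_Lm x : E1_op (Lm x) = Lm (E1_op x).
Proof. by normalize. Qed.
Lemma E2_t x : E2_op (t x) = t (E2_op x).
Proof. by normalize. Qed.
Lemma E2_Lm x : E2_op (Lm x) = Lm (E2_op x).
Proof. by normalize. Qed.

Lemma h_E1 x : h_op (E1_op x) = E1_op (h_op x) + E1_op x.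
Proof. by rewrite /h_op L0_E1 -E1_Lm -E1_t addrAC -linearB. Qed.
Lemma h_E2 x : h_op (E2_op x) = E2_op (h_op x) + 2 *: E2_op x.
Proof. by rewrite /h_op L0_E2 -E2_Lm -E2_t addrAC -linearB. Qed.

End ContactTheory.

(** * The density vector *)
Lemma weight_h (F : numFieldType) (V : lmodType F) (C : contact_ops V) mu x :
  op_L0 C x = mu *: x -> op_L0 C (h_op C x) = mu *: h_op C x.
Proof.
move=> wt_x; have -> : op_L0 C (h_op C x) = h_op C (op_L0 C x).
  by rewrite /h_op linearB /= op_L0_t op_L0_Lm linearB /=; lmod.
by rewrite wt_x linearZ.
Qed.

Section TopVector.
Variables (F : numClosedFieldType) (V : lmodType F) (C : contact_ops V).
Local Notation t := (op_t C).
Local Notation xi := (op_xi C).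
Local Notation Lm := (op_Lm C).
Local Notation L0 := (op_L0 C).
Local Notation L1 := (op_L1 C).
Local Notation L2 := (op_L2 C).
Local Notation G := (op_G C).
Local Notation dxi := (dxi_op C).
Local Notation h := (h_op C).
Local Notation E1 := (E1_op C).
Local Notation E2 := (E2_op C).
Implicit Types (x u v y : V) (lam b mu : F).

(** The equations satisfied by [t^k] in [Gamma (lam - k, b)]: the exponent is
    [lam] and the density weight is [b]. *)
Definition density lam b u := [/\ G u = xi (Lm u), t (Lm u) = lam *: u,
  L0 u = (lam + b) *: u, L1 u = (lam + 2 * b) *: t u
  & L2 u = (lam + 3 * b) *: t (t u)].

Definition h_eigenvector_at mu b x := [/\ x != 0, L0 x = mu *: x & h x = b *: x].

(** The equations [dxi u = E1 u = E2 u = 0], solved for [G u], [L_1 u] and [L_2 u]. *)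
Lemma densityP mu b u :
    dxi u = 0 -> h u = b *: u -> L0 u = mu *: u -> E1 u = 0 -> E2 u = 0 ->
  density (mu - b) b u.
Proof.
move=> dxi_u h_u L0_u E1_u E2_u.
have tLm_u : t (Lm u) = (mu - b) *: u.
  by rewrite scalerBl -L0_u -h_u /h_op opprB addrC subrK.
have L1_u : L1 u = (mu - b + 2 * b) *: t u.
  have -> : L1 u = E1 u + 2 *: t (L0 u) - t (t (Lm u)) by rewrite /E1_op; lmod.
  by rewrite E1_u L0_u tLm_u !linearZ /=; lmod.
split=> //; first by apply/esym/eqP; rewrite -subr_eq0 -/(dxi u) dxi_u.
  by rewrite subrK.
have -> : L2 u = E2 u + 3 *: t (L1 u) - 3 *: t (t (L0 u)) + t (t (t (Lm u))).
  by rewrite /E2_op; lmod.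
by rewrite E2_u L1_u L0_u tLm_u !linearZ /=; lmod.
Qed.

Lemma density_t lam b u : density lam b u -> density (lam + 1) b (t u).
Proof.
case=> G_u tLm_u L0_u L1_u L2_u; split.
- by rewrite op_G_t op_Lm_t G_u linearD /= op_xi_t.
- by rewrite op_Lm_t linearD /= tLm_u linearZ /=; lmod.
- by rewrite op_L0_t L0_u linearZ /=; lmod.
- by rewrite op_L1_t L1_u linearZ /=; lmod.
- by rewrite op_L2_t L2_u linearZ /=; lmod.
Qed.

Lemma density_Lm lam b u : density lam b u -> density (lam - 1) b (Lm u).
Proof.
case=> G_u tLm_u L0_u L1_u L2_u.
have Lmt_u : Lm (t u) = (lam + 1) *: u by rewrite op_Lm_t tLm_u; lmod.
split.
- by rewrite op_G_Lm G_u op_Lm_xi.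
- have -> : t (Lm (Lm u)) = Lm (t (Lm u)) - Lm u by rewrite op_Lm_t; lmod.
  by rewrite tLm_u linearZ /=; lmod.
- by rewrite op_L0_Lm L0_u linearZ /=; lmod.
- by rewrite op_L1_Lm L1_u L0_u linearZ /= Lmt_u tLm_u; lmod.
- by rewrite op_L2_Lm L2_u L1_u tLm_u !(linear_rules Lm) op_Lm_t Lmt_u !(linear_rules t); lmod.
Qed.

Section Existence.
Variables (lam0 : F) (rs : seq F).
Hypothesis lam0_spanned : fin_spanned (fun x => L0 x = lam0 *: x).
Hypothesis lam0_weight : exists2 x, x != 0 & L0 x = lam0 *: x.
Hypothesis h_bounded : forall (m : int) x b,
  h_eigenvector_at (lam0 + m%:~R) b x ->
  b \in rs \/ exists i : nat, b = lam0 + 2^-1 - i%:R / 2.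

(* Both cosets are admitted because [xi] and [dxi] exchange the weights in
   [lam0 + Z] with those in [lam0 + 1/2 + Z]. *)
Let near_weight b := exists (j : int) x, h_eigenvector_at (lam0 + j%:~R / 2) b x.

(** For an eigenvector [x] of [h] at a weight in [lam0 + 1/2 + Z], one of [xi x] and
    [dxi x] is not zero, and it is an eigenvector at a weight in [lam0 + Z] whose
    eigenvalue differs by [1/2] or [- 1/2]. *)
Lemma near_weight_bounded b0 :
  exists B, forall j : nat, near_weight (b0 + j%:R / 2) -> (j <= B)%N.
Proof.
have near_shift b : near_weight b -> exists2 e, e \in [:: 0; 2^-1; - 2^-1] &
    b + e \in rs \/ exists i : nat, b + e = lam0 + 2^-1 - i%:R / 2.
  case=> j [x [x0 wt_x h_x]]; have [m [jE|jE]] := int_even_or_odd j.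
    exists 0; first by rewrite inE eqxx.
    rewrite addr0; apply: (h_bounded (m := m) (x := x)); split=> //.
    by rewrite wt_x jE rmorphM /=; congr (_ *: _); field.
  have [xi_x0|xi_x] := eqVneq (xi x) 0.
    exists (- 2^-1); first by rewrite !inE eqxx !orbT.
    apply: (h_bounded (m := m) (x := dxi x)); split.
    - apply: contraNneq x0 => dxi_x0.
      by rewrite -(clifford C x) xi_x0 dxi_x0 !linear0 addr0.
    - rewrite L0_dxi wt_x linearZ /= -scalerBl jE rmorphD rmorphM /=.
      by congr (_ *: _); field.
    - by rewrite h_dxi h_x linearZ /= -scalerBl.
  exists 2^-1; first by rewrite !inE eqxx !orbT.
  apply: (h_bounded (m := m + 1) (x := xi x)); split=> //.
  - rewrite op_L0_xi wt_x linearZ /= -scalerDl jE !rmorphD rmorphM /=.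
    by congr (_ *: _); field.
  - by rewrite h_xi h_x linearZ /= -scalerDl.
have bounded_shift e : exists B, forall j : nat,
    b0 + j%:R / 2 + e \in rs \/
      (exists i : nat, b0 + j%:R / 2 + e = lam0 + 2^-1 - i%:R / 2) -> (j <= B)%N.
  have [B1 le1] := half_steps_bounded (b0 + e) rs.
  have [B2 le2] := half_descent_bounded (b0 + e) (lam0 + 2^-1).
  exists (maxn B1 B2) => j; rewrite addrAC leq_max.
  by case=> [/le1->//|[i /le2->]]; rewrite orbT.
have [B1 le1] := bounded_shift 0.
have [B2 le2] := bounded_shift 2^-1.
have [B3 le3] := bounded_shift (- 2^-1).
exists (maxn B1 (maxn B2 B3)) => j /near_shift[e]; rewrite !leq_max !inE.
case/or3P=> /eqP-> le_j; first by rewrite le1.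
  by rewrite le2 ?orbT.
by rewrite le3 ?orbT.
Qed.

Lemma top_eigenvector : exists b, near_weight b /\
  forall i : nat, ~ near_weight (b + i.+1%:R / 2).
Proof.
have [x0 nz_x0 wt_x0] := lam0_weight.
have wtZD c x y : L0 x = lam0 *: x -> L0 y = lam0 *: y ->
    L0 (c *: x + y) = lam0 *: (c *: x + y).
  by move=> wt_x wt_y; rewrite linearP /= wt_x wt_y; lmod.
have wt_h := @weight_h _ _ C lam0.
have [rs0 annih] := fin_spanned_annihilator lam0_spanned wt_h.
have [x [b0 [nz_x wt_x h_x]]] :=
  annihilated_eigenvector wtZD wt_h (annih _ wt_x0) nz_x0 wt_x0.
have near_b0 : near_weight b0 by exists 0, x; split; rewrite // mul0r addr0.
have [B leB] := near_weight_bounded b0.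
pose P (j : nat) := `[< near_weight (b0 + j%:R / 2) >].
have exP : exists j, P j by exists 0%N; apply/asboolP; rewrite mul0r addr0.
have ubP j : P j -> (j <= B)%N by move=> /asboolP/leB.
case: (ex_maxnP exP ubP) => j /asboolP near_j max_j.
exists (b0 + j%:R / 2); split=> // i near_i.
suff /max_j : P (j + i.+1)%N by rewrite leqNgt -addSnnS leq_addr.
by apply/asboolP; rewrite natrD mulrDl addrA.
Qed.

(** If the eigenvalue [beta] of [v] is maximal, vectors of eigenvalue [beta + 1/2],
    [beta + 1], ... vanish. This applies to [xi v], and to [E1 u] and [E2 u] for
    [u = dxi v], whose eigenvalue is [b = beta - 1/2]. The last clause keeps the
    maximality, on which [Lmm_density] relies. *)
Lemma density_vector_exists : exists lam b (j : int) u,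
  [/\ u != 0, density lam b u, lam + b = lam0 + j%:~R / 2 &
      forall (j' : int) (i : nat) y, L0 y = (lam0 + j'%:~R / 2) *: y ->
        h y = (b + 1 + i%:R / 2) *: y -> y = 0].
Proof.
have [b [[j [v [nz_v wt_v h_v]]] top]] := top_eigenvector.
have top0 (j' : int) (i : nat) y : L0 y = (lam0 + j'%:~R / 2) *: y ->
    h y = (b - 2^-1 + 1 + i%:R / 2) *: y -> y = 0.
  move=> wt_y h_y; apply/eqP/negP => /negP nz_y; apply: (top i).
  exists j', y; split=> //; rewrite h_y; congr (_ *: _).
  by rewrite -addn1 natrD; field.
have xi_v : xi v = 0.
  apply: (top0 (j + 1) 0%N).
    by rewrite op_L0_xi wt_v linearZ /= -scalerDl rmorphD /=; congr (_ *: _); field.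
  by rewrite h_xi h_v linearZ /= -scalerDl; congr (_ *: _); field.
pose u := dxi v.
have wt_u : L0 u = (lam0 + (j - 1)%:~R / 2) *: u.
  by rewrite L0_dxi wt_v linearZ /= -scalerBl rmorphB /=; congr (_ *: _); field.
have h_u : h u = (b - 2^-1) *: u by rewrite h_dxi h_v linearZ /= -scalerBl.
have E1_u : E1 u = 0.
  apply: (top0 (j + 1) 0%N).
    rewrite L0_E1 wt_u linearZ /= -{2}[E1 u]scale1r -scalerDl rmorphB rmorphD /=.
    by congr (_ *: _); field.
  rewrite h_E1 h_u linearZ /= -{2}[E1 u]scale1r -scalerDl.
  by congr (_ *: _); field.
have E2_u : E2 u = 0.
  apply: (top0 (j + 3) 2%N).
    rewrite L0_E2 wt_u linearZ /= -scalerDl rmorphB rmorphD /=.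
    by congr (_ *: _); field.
  by rewrite h_E2 h_u linearZ /= -scalerDl; congr (_ *: _); field.
exists (lam0 + (j - 1)%:~R / 2 - (b - 2^-1)), (b - 2^-1), (j - 1), u.
split=> //; last by rewrite subrK.
  apply: contraNneq nz_v => u0.
  by rewrite -(clifford C v) xi_v -/u u0 !linear0 addr0.
exact: densityP (dxi_dxi C v) h_u wt_u E1_u E2_u.
Qed.

End Existence.
End TopVector.

(** * The generator L_(-2) when t is invertible *)
Lemma fin_spanned_sum (F : numFieldType) (V : lmodType F) (W1 W2 W : V -> Prop)
    (f1 f2 : {linear V -> V}) (g1 g2 : V -> V) :
    (forall x, W1 x -> W (f1 x)) -> (forall x, W2 x -> W (f2 x)) ->
    (forall x, W x -> [/\ W1 (g1 x), W2 (g2 x) & x = f1 (g1 x) + f2 (g2 x)]) ->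
  fin_spanned W1 -> fin_spanned W2 -> fin_spanned W.
Proof.
move=> Wf1 Wf2 decomp [n1 [e1 [We1 span1]]] [n2 [e2 [We2 span2]]].
exists (n1 + n2)%N, (fun i => match split i with inl k => f1 (e1 k) | inr k => f2 (e2 k) end).
split=> [i|x /decomp[/span1[c1 g1E] /span2[c2 g2E] ->]].
  by case: (split i) => k; [apply/Wf1/We1 | apply/Wf2/We2].
exists (fun i => match split i with inl k => c1 k | inr k => c2 k end).
rewrite big_split_ord /= g1E g2E !linear_sum /=; congr (_ + _); apply: eq_bigr => k _.
  by rewrite linearZ (unsplitK (inl k)).
by rewrite linearZ (unsplitK (inr k)).
Qed.

Section InvertibleT.
Variables (F : numClosedFieldType) (V : lmodType F) (C : contact_ops V).
Local Notation t := (op_t C).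
Local Notation xi := (op_xi C).
Local Notation Lm := (op_Lm C).
Local Notation L0 := (op_L0 C).
Local Notation L1 := (op_L1 C).
Local Notation L2 := (op_L2 C).
Local Notation G := (op_G C).
Local Notation dxi := (dxi_op C).
Local Notation h := (h_op C).
Local Notation E1 := (E1_op C).
Local Notation wt mu := (fun x => L0 x = mu *: x).
Variable ti : {linear V -> V}.
Hypothesis t_ti : forall x, t (ti x) = x.
Hypothesis ti_t : forall x, ti (t x) = x.
Implicit Types (x u v y : V) (lam b mu : F).

Lemma L0_ti x : L0 (ti x) = ti (L0 x) - ti x.
Proof. by rewrite -{2}(t_ti x) op_L0_t linearD /= !ti_t addrK. Qed.

Lemma fin_spanned_weight_D1 mu : fin_spanned (wt mu) -> fin_spanned (wt (mu + 1)).
Proof.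
move=> fin; apply: (fin_spanned_sum (f1 := t) (f2 := t) (g1 := ti) (g2 := fun=> 0) _ _ _ fin fin).
- by move=> x wt_x; rewrite op_L0_t wt_x linearZ /=; lmod.
- by move=> x wt_x; rewrite op_L0_t wt_x linearZ /=; lmod.
- move=> x wt_x; split; rewrite ?linear0 ?scaler0 ?t_ti ?addr0 //.
  by rewrite L0_ti wt_x linearZ /=; lmod.
Qed.

Lemma fin_spanned_weight_B1 mu : fin_spanned (wt mu) -> fin_spanned (wt (mu - 1)).
Proof.
move=> fin; apply: (fin_spanned_sum (f1 := ti) (f2 := ti) (g1 := t) (g2 := fun=> 0) _ _ _ fin fin).
- by move=> x wt_x; rewrite L0_ti wt_x linearZ /=; lmod.
- by move=> x wt_x; rewrite L0_ti wt_x linearZ /=; lmod.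
- move=> x wt_x; split; rewrite ?linear0 ?scaler0 ?ti_t ?addr0 //.
  by rewrite op_L0_t wt_x linearZ /=; lmod.
Qed.

(** By the Clifford relation, [x] is the sum of [xi (dxi x)] and [dxi (xi x)], and
    [dxi x], [xi x] lie in weight spaces at integral distance. *)
Lemma fin_spanned_weight_half mu :
  fin_spanned (wt mu) -> fin_spanned (wt (mu + 2^-1)).
Proof.
move=> fin; apply: (fin_spanned_sum (f1 := xi) (f2 := dxi_op C) (g1 := dxi) (g2 := xi)
  _ _ _ fin (fin_spanned_weight_D1 fin)).
- by move=> x wt_x; rewrite op_L0_xi wt_x linearZ /=; lmod.
- by move=> x wt_x; rewrite L0_dxi wt_x linearZ /= -scalerBl; congr (_ *: _); field.
- move=> x wt_x; split; last by rewrite addrC clifford.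
    by rewrite L0_dxi wt_x linearZ /= -scalerBl; congr (_ *: _); field.
  by rewrite op_L0_xi wt_x linearZ /= -scalerDl; congr (_ *: _); field.
Qed.

Lemma fin_spanned_weight_steps mu (j : int) :
  fin_spanned (wt mu) -> fin_spanned (wt (mu + j%:~R / 2)).
Proof.
have steps nu (m : int) : fin_spanned (wt nu) -> fin_spanned (wt (nu + m%:~R)).
  move=> fin; case: m => n.
    elim: n => [|n IH]; first by rewrite addr0.
    have -> : nu + n.+1%:~R = nu + n%:~R + 1 by rewrite intS rmorphD /= (addrC 1) addrA.
    exact: fin_spanned_weight_D1.
  rewrite NegzE; elim: n => [|n IH]; first exact: fin_spanned_weight_B1.
  have -> : nu + (- n.+2%:Z)%:~R = nu + (- n.+1%:Z)%:~R - 1.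
    by rewrite intS opprD rmorphD /= (addrC (- _)) addrA.
  exact: fin_spanned_weight_B1.
move=> fin; have [m [->|->]] := int_even_or_odd j.
  by rewrite rmorphM /= mulrC mulKf ?pnatr_eq0 //; apply: steps.
rewrite rmorphD rmorphM /= mulrDl (mulrAC _ _ (2^-1)) divff ?pnatr_eq0 //.
by rewrite !mul1r addrA; apply/fin_spanned_weight_half/steps.
Qed.

Variable Lmm : {linear V -> V}.
Hypothesis Lmm_t : forall x, Lmm (t x) = t (Lmm x) + ti x.
Hypothesis L0_Lmm : forall x, L0 (Lmm x) = Lmm (L0 x) - 2 *: Lmm x.
Hypothesis L1_Lmm : forall x, L1 (Lmm x) = Lmm (L1 x) - 3 *: Lm x.

Let ordered := (op_Lm_t C, op_L0_t C, op_L1_t C,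
  op_L0_Lm C, op_L1_Lm C, op_L1_L0 C, Lmm_t, L0_Lmm, L1_Lmm, t_ti).
Let lin := (linear_rules t, linear_rules Lm, linear_rules L0,
  linear_rules L1, linear_rules Lmm).
(** Up to a power of [t], these play the roles of [E2_op] and [h_op] for the
    coordinate [1 / t], in which [L_n] becomes [- L_(-n)]. *)
Definition D_op x := L1 x - 3 *: t (L0 x) + 3 *: t (t (Lm x)) - t (t (t (Lmm x))).
Definition H_op x := L1 x - t (L0 x).
Ltac normalize := rewrite /D_op /H_op; rewrite ?(ordered, lin); lmod.

Lemma D_op_linear : linear D_op.
Proof. by move=> c x y; normalize. Qed.
HB.instance Definition _ := GRing.isLinear.Build F V V *:%R D_op D_op_linear.
Lemma H_op_linear : linear H_op.
Proof. by move=> c x y; normalize. Qed.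
HB.instance Definition _ := GRing.isLinear.Build F V V *:%R H_op H_op_linear.

Lemma D_t x : D_op (t x) = t (D_op x).
Proof. by normalize. Qed.
Lemma H_t x : H_op (t x) = t (H_op x).
Proof. by normalize. Qed.
Lemma L0_D x : L0 (D_op x) = D_op (L0 x) + D_op x.
Proof. by normalize. Qed.
Lemma L0_H x : L0 (H_op x) = H_op (L0 x) + H_op x.
Proof. by normalize. Qed.
Lemma L1_D x : L1 (D_op x) = D_op (L1 x) + 3 *: t (D_op x).
Proof. by normalize. Qed.
Lemma H_D x : H_op (D_op x) = D_op (H_op x) + 2 *: t (D_op x).
Proof.
have D_B y z : D_op (y - z) = D_op y - D_op z by apply: linearB.
by rewrite /H_op L1_D L0_D D_B D_t !lin; lmod.
Qed.
Lemma H_opE x : H_op x = E1 x + t (h x).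
Proof. by rewrite /H_op /E1_op /h_op !lin; lmod. Qed.

Section LowerGenerator.
Variables (lam b : F) (u : V).
Hypothesis density_u : density C lam b u.
Hypothesis weight_u_spanned : fin_spanned (wt (lam + b)).
Hypothesis no_above : forall (i : nat) y, L0 y = (lam + b) *: y ->
  h y = (b + 1 + i%:R / 2) *: y -> y = 0.

(* [N_op] and [K_op] preserve weights, so they act on one finite dimensional
   space, where [N_op] raises the eigenvalues of [K_op] by one. *)
Let N_op x := ti (E1 x).
Let K_op x := ti (H_op x).

Let N_op_linear : linear N_op.
Proof. by move=> c x y; rewrite /N_op !linearP. Qed.
HB.instance Definition _ := GRing.isLinear.Build F V V *:%R N_op N_op_linear.
Let K_op_linear : linear K_op.
Proof. by move=> c x y; rewrite /K_op !linearP. Qed.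
HB.instance Definition _ := GRing.isLinear.Build F V V *:%R K_op K_op_linear.

Let K_N x : K_op (N_op x) = N_op (K_op x) + N_op x.
Proof.
have E1_ti y : E1 (ti y) = ti (E1 y) by rewrite -{2}(t_ti y) E1_t ti_t.
have H_ti y : H_op (ti y) = ti (H_op y) by rewrite -{2}(t_ti y) H_t ti_t.
have E1_D y z : E1 (y + z) = E1 y + E1 z by apply: linearD.
rewrite /K_op /N_op H_ti E1_ti (H_opE (E1 x)) (H_opE x) h_E1 (E1_D (E1 x)) E1_t.
move: (E1 (E1 x)) (E1 (h x)) (E1 x) => y z w.
by rewrite !(linear_rules t, linear_rules ti) !ti_t addrA.
Qed.

(** A nonzero [D u] would start a chain of eigenvectors of [K_op] along [N_op] with
    eigenvalues [b + 2 + i]; it has to stop, and its last member is annihilated by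
    [E1], so [K_op] and [h] agree on it, against [no_above]. *)
Lemma D_density_eq0 : D_op u = 0.
Proof.
have [_ tLm_u L0_u L1_u _] := density_u.
have H_ti y : H_op (ti y) = ti (H_op y) by rewrite -{2}(t_ti y) H_t ti_t.
have wt_K x : L0 x = (lam + b) *: x -> L0 (K_op x) = (lam + b) *: K_op x.
  by move=> wt_x; rewrite /K_op L0_ti L0_H wt_x (linear_rules ti) addrK -linearZ /= -linearZ.
have wt_N x : L0 x = (lam + b) *: x -> L0 (N_op x) = (lam + b) *: N_op x.
  by move=> wt_x; rewrite /N_op L0_ti L0_E1 wt_x (linear_rules ti) addrK -linearZ /= -linearZ.
have [rs annih] := fin_spanned_annihilator weight_u_spanned wt_K.
pose y i := iter i N_op (ti (D_op u)).
have wt_y i : L0 (y i) = (lam + b) *: y i.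
  elim: i => [|i IH]; last exact: wt_N.
  by rewrite /y /= L0_ti L0_D L0_u (linear_rules ti) addrK -linearZ /= -linearZ.
have K_y i : K_op (y i) = (b + 2 + i%:R) *: y i.
  elim: i => [|i IH].
    rewrite /y /= addr0 /K_op H_ti H_D.
    have -> : H_op u = b *: t u by rewrite /H_op L1_u L0_u linearZ /=; lmod.
    have D_Z c z : D_op (c *: z) = c *: D_op z by apply: linearZ_LR.
    rewrite D_Z D_t; move: (D_op u) => z.
    by rewrite !(linear_rules ti) !ti_t; lmod.
  by rewrite /y /= -/(y i) K_N IH linearZ /= -addn1 natrD; lmod.
have [B leB] := half_steps_bounded (b + 2) rs.
(* [half_steps_bounded] counts half steps, hence the doubling. *)
have exy : exists i, y i == 0.
  exists B.+1; apply/negP => /negP nz_y.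
  have /leB : b + 2 + (B.+1).*2%:R / 2 \in rs.
    have := annihilated_eigenvalue (annih _ (wt_y B.+1)) nz_y (K_y B.+1).
    by rewrite -muln2 natrM mulfK // pnatr_eq0.
  by rewrite doubleS -addnn; lia.
case: (ex_minnP exy) => -[/eqP y0|k /eqP yk min_k].
  by move=> _; rewrite -[D_op u]t_ti; rewrite /y /= in y0; rewrite y0 linear0.
have nz_y : y k != 0 by apply/negP => /min_k; rewrite ltnn.
case/eqP: nz_y; apply: (no_above (i := (k.+1).*2) (wt_y k)).
have E1_y : E1 (y k) = 0 by rewrite -[E1 _]t_ti -/(N_op (y k)) -[N_op _]/(y k.+1) yk linear0.
have <- : K_op (y k) = h (y k) by rewrite /K_op H_opE E1_y add0r ti_t.
rewrite K_y; congr (_ *: _); rewrite -muln2 natrM mulfK ?pnatr_eq0 //.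
by rewrite -addn1 natrD; ring.
Qed.

Lemma Lmm_density : Lmm u = (lam - b) *: ti (ti u).
Proof.
have [_ tLm_u L0_u L1_u _] := density_u.
have tttLmm_u : t (t (t (Lmm u))) = (lam - b) *: t u.
  have -> : t (t (t (Lmm u))) = L1 u - 3 *: t (L0 u) + 3 *: t (t (Lm u)) - D_op u.
    by rewrite /D_op; lmod.
  by rewrite D_density_eq0 L1_u L0_u tLm_u !linearZ /=; lmod.
by rewrite -[Lmm u]ti_t -[t _]ti_t -[t (t _)]ti_t tttLmm_u !linearZ /= ti_t.
Qed.

End LowerGenerator.
End InvertibleT.

Section Steps.
Variables (F : numClosedFieldType) (V : lmodType F) (C : contact_ops V) (lam0 : F).
Local Notation near b := (exists i : nat, b = lam0 + 2^-1 - i%:R / 2).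

(** To compare the eigenvalues of [h] with those on the weight space of [lam0] it
    suffices to move an eigenvector one step towards [lam0], unless its
    eigenvalue is bounded for another reason. *)
Lemma h_bounded_of_steps :
    fin_spanned (fun x => op_L0 C x = lam0 *: x) ->
    (forall (n : nat) b x, h_eigenvector_at C (lam0 + n.+1%:R) b x ->
      (exists y, h_eigenvector_at C (lam0 + n%:R) b y) \/ near b) ->
    (forall (n : nat) b x, h_eigenvector_at C (lam0 - n.+1%:R) b x ->
      (exists y, h_eigenvector_at C (lam0 - n%:R) b y) \/ near b) ->
  exists rs : seq F, forall (m : int) x b,
    h_eigenvector_at C (lam0 + m%:~R) b x -> b \in rs \/ near b.
Proof.
move=> fin down up; have [rs annih] := fin_spanned_annihilator fin (@weight_h _ _ C lam0).
have at0 b x : h_eigenvector_at C lam0 b x -> b \in rs \/ near b.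
  by case=> nz_x wt_x h_x; left; apply: annihilated_eigenvalue (annih _ wt_x) nz_x h_x.
exists rs => -[n|n] x b.
  elim: n x => [|n IH] x; first by rewrite addr0; apply: at0.
  by case/down => [[y /IH]|]; [|right].
have -> : lam0 + (Negz n)%:~R = lam0 - n.+1%:R by rewrite NegzE rmorphN.
elim: n x => [|n IH] x ev.
  by have [[y]|] := up 0%N b x ev; [rewrite subr0; apply: at0 | right].
by have [[y /IH]|] := up n.+1 b x ev; [|right].
Qed.

Lemma h_bounded_invertible (ti : {linear V -> V}) :
    (forall x, op_t C (ti x) = x) -> (forall x, ti (op_t C x) = x) ->
    fin_spanned (fun x => op_L0 C x = lam0 *: x) ->
  exists rs : seq F, forall (m : int) x b,
    h_eigenvector_at C (lam0 + m%:~R) b x -> b \in rs \/ near b.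
Proof.
move=> t_ti ti_t fin; apply: (h_bounded_of_steps fin) => n b x [nz_x wt_x h_x]; left.
  exists (ti x); split.
  - by apply: contraNneq nz_x => ti_x; rewrite -(t_ti x) ti_x linear0.
  - by rewrite (L0_ti t_ti ti_t) wt_x linearZ /= -addn1 natrD; lmod.
  - by rewrite -[h_op C _]ti_t -h_t t_ti h_x linearZ.
exists (op_t C x); split.
- by apply: contraNneq nz_x => t_x; rewrite -(ti_t x) t_x linear0.
- by rewrite op_L0_t wt_x linearZ /= -addn1 natrD; lmod.
- by rewrite h_t h_x linearZ.
Qed.

End Steps.

(** * Strings for the Weyl algebra of t and L_(-1) *)
Section WeylStrings.
Variables (F : numClosedFieldType) (V : lmodType F) (C : contact_ops V).
Local Notation t := (op_t C).
Local Notation Lm := (op_Lm C).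
(* In the application [K] is a parity component. *)
Variable K : V -> Prop.
Hypothesis K_t : forall x, K x -> K (t x).
Hypothesis K_Lm : forall x, K x -> K (Lm x).
Hypothesis K_Z : forall c x, K x -> K (c *: x).
Implicit Types (x u v y : V) (lam b : F).

Lemma density_Z lam b c u : density C lam b u -> density C lam b (c *: u).
Proof.
case=> G_u tLm_u L0_u L1_u L2_u.
split; rewrite !(linear_rules (op_G C), linear_rules (op_L0 C), linear_rules (op_L1 C),
  linear_rules (op_L2 C), linear_rules Lm, linear_rules t, linear_rules (op_xi C));
  by rewrite ?G_u ?tLm_u ?L0_u ?L1_u ?L2_u; lmod.
Qed.

Definition weyl_string lam b (x : int -> V) := forall k : int,
  [/\ K (x k), density C (lam + k%:~R) b (x k), t (x k) = x (k + 1)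
    & Lm (x k) = (lam + k%:~R) *: x (k - 1)].

(** Upwards the string consists of the [t^n u]. Downwards [L_(-1)] is divided by
    the exponents [lam - n], which must not vanish; then [t] leads back. *)
Lemma weyl_string_exists lam b u :
    u != 0 -> K u -> density C lam b u -> (forall n : nat, lam != n%:R) ->
  exists x : int -> V, [/\ weyl_string lam b x, x 0 = u & forall n : nat, x (- n%:Z) != 0].
Proof.
move=> nz_u Ku den_u lam_n.
pose down := fix down n := if n is n'.+1 then (lam - n'%:R)^-1 *: Lm (down n') else u.
pose x (k : int) := match k with Posz n => iter n t u | Negz n => down n.+1 end.
have xN n : x (- n%:Z) = down n by case: n.
have nz_lam n : lam - n%:R != 0 by rewrite subr_eq0 lam_n.
have downP n : K (down n) /\ density C (lam - n%:R) b (down n).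
  elim: n => [|n [IHK IHd]]; first by rewrite subr0.
  split; first by apply/K_Z/K_Lm.
  by apply: density_Z; rewrite -addn1 natrD opprD addrA; apply: density_Lm.
have upP n : K (iter n t u) /\ density C (lam + n%:R) b (iter n t u).
  elim: n => [|n [IHK IHd]]; first by rewrite addr0.
  split; first by apply/K_t.
  by rewrite -addn1 natrD addrA addn1; apply: density_t.
have t_down n : t (down n.+1) = down n.
  have [_ [_ tLm _ _ _]] := downP n.
  by rewrite /= linearZ /= tLm scalerA mulVf // scale1r.
have Lm_down n : Lm (down n) = (lam - n%:R) *: down n.+1.
  by rewrite /= scalerA divff // scale1r.
have Lm_up n : Lm (iter n.+1 t u) = (lam + n.+1%:R) *: iter n t u.
  have [_ [_ tLm _ _ _]] := upP n.
  by rewrite /= op_Lm_t tLm -addn1 natrD; lmod.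
exists x; split=> // [k|n]; last first.
  rewrite xN; elim: n => [//|n IH]; apply: contraNneq IH => down0.
  by rewrite -t_down down0 linear0.
case: k => n.
  have [Kn dn] := upP n; split=> //; first by rewrite -PoszD addn1.
  case: n {Kn dn} => [|n]; last first.
    by rewrite (_ : n.+1%:Z - 1 = n); [apply: Lm_up | lia].
  by rewrite addr0 (Lm_down 0%N) subr0.
have [Kn dn] := downP n.+1.
have nE : lam + (Negz n)%:~R = lam - n.+1%:R by rewrite NegzE rmorphN.
split; rewrite ?nE //.
  by rewrite -[LHS]/(t (down n.+1)) t_down -xN; congr x; lia.
by rewrite -[LHS]/(Lm (down n.+1)) Lm_down; congr (_ *: _); rewrite -xN; congr x; lia.
Qed.

(** The eigenvalue of [t * L_(-1)] can be lowered by [L_(-1)] as long as it is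
    not [0], and raised by [t] as long as it is not [-1]. *)
Lemma density_integral_exponent b (m : int) u :
    u != 0 -> K u -> density C m%:~R b u ->
  (exists v, [/\ v != 0, K v, density C 0 b v & Lm v = 0]) \/
  (exists v, [/\ v != 0, K v, density C (-1) b v & t v = 0]).
Proof.
move=> nz_u Ku den_u.
suff [[v [nz_v Kv den_v]]|[v [nz_v Kv den_v]]] :
    (exists v, [/\ v != 0, K v & density C 0 b v]) \/
    (exists v, [/\ v != 0, K v & density C (-1) b v]).
- have [Lm_v|Lm_v] := eqVneq (Lm v) 0; first by left; exists v.
  right; exists (Lm v); split=> //; first exact: K_Lm.
    by rewrite -[-1]add0r; apply: density_Lm.
  by have [_ -> _ _ _] := den_v; rewrite scale0r.
- have [t_v|t_v] := eqVneq (t v) 0; first by right; exists v.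
  left; exists (t v); split=> //; first exact: K_t.
    by rewrite -[0](addNr 1); apply: density_t.
  by rewrite op_Lm_t; have [_ -> _ _ _] := den_v; rewrite scaleN1r addNr.
case: m den_u => n.
  elim: n u nz_u Ku => [|n IH] u nz_u Ku den_u; first by left; exists u.
  apply: (IH (Lm u)).
  - have [_ tLm_u _ _ _] := den_u; apply: contraNneq nz_u => Lm_u.
    move/eqP: tLm_u; rewrite Lm_u linear0 eq_sym scaler_eq0 => /orP[|//].
    by rewrite intr_eq0.
  - exact: K_Lm.
  - by move/density_Lm: den_u; rewrite -[n.+1]addn1 PoszD rmorphD /= addrK.
elim: n u nz_u Ku => [|n IH] u nz_u Ku den_u; first by right; exists u.
have den_tu : density C (Negz n)%:~R b (t u).
  move/density_t: den_u; rewrite !NegzE -[n.+2]addn1 PoszD opprD rmorphD /=.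
  by rewrite rmorphN1 subrK.
apply: (IH (t u)) => //; last exact: K_t.
have [_ tLm_u _ _ _] := den_u; apply: contraNneq nz_u => t_u.
have := op_Lm_t C u; rewrite t_u linear0 tLm_u => /esym/eqP.
rewrite -{2}[u]scale1r -scalerDl scaler_eq0 -(rmorph1 (intmul 1)) -rmorphD.
by rewrite intr_eq0 => /orP[/eqP|/eqP//]; lia.
Qed.

End WeylStrings.

(** * Brackets of basis elements *)
Section LinearExtension.
Variables (F : fieldType) (K : choiceType).
Implicit Types (x y : {malg F[K]}) (i : K).

Lemma lextEw (V : lmodType F) (f : K -> V) x (d : {fset K}) :
  (msupp x `<=` d)%fset -> lext f x = \sum_(i <- d) x@_i *: f i.
Proof.
move=> le_xd; rewrite /lext (big_fset_incl _ le_xd) //= => i _ i_x.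
by rewrite mcoeff_outdom ?scale0r.
Qed.

Lemma lext_linear (V : lmodType F) (f : K -> V) : linear (lext f).
Proof.
move=> c x y; pose d := (msupp x `|` msupp y)%fset.
have le_x : (msupp x `<=` d)%fset by apply: fsubsetUl.
have le_y : (msupp y `<=` d)%fset by apply: fsubsetUr.
have le_xy : (msupp (c *: x + y) `<=` d)%fset.
  by apply: fsubset_trans (msuppD_le _ _) _; apply: fsetUSS (msuppZ_le _ _) _.
rewrite (lextEw f le_x) (lextEw f le_y) (lextEw f le_xy) scaler_sumr -big_split /=.
by apply: eq_bigr => i _; rewrite mcoeffD mcoeffZ scalerDl scalerA.
Qed.
HB.instance Definition _ (V : lmodType F) (f : K -> V) :=
  GRing.isLinear.Build F {malg F[K]} V *:%R (lext f) (lext_linear f).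

Lemma lextU (V : lmodType F) (f : K -> V) i : lext f << i >> = f i.
Proof.
by rewrite /lext msuppU oner_eq0 big_seq_fset1 mcoeffUU scale1r.
Qed.

Lemma lext0 (V : lmodType F) (f : K -> V) : lext f 0 = 0.
Proof. exact: linear0. Qed.

Lemma lext_eq0 (V : lmodType F) (f : K -> V) x : (forall i, f i = 0) -> lext f x = 0.
Proof. by move=> f0; rewrite /lext big1 // => i _; rewrite f0 scaler0. Qed.

Lemma lext_basis x : lext (fun i => << i >>) x = x.
Proof.
rewrite [RHS]monalgE; apply: eq_bigr => i _; apply/malgP => j.
by rewrite mcoeffZ !mcoeffU mulr_natr.
Qed.

Lemma homogU (d : K -> bool) i : << i >> \in @homog F K d (d i).
Proof.
apply/allP => j; rewrite msuppU oner_eq0 inE => /eqP->.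
by rewrite eqxx.
Qed.

Lemma homog0 (d : K -> bool) p : 0 \in @homog F K d p.
Proof. by apply/allP => j; rewrite msupp0. Qed.

Lemma supportedU (P : pred K) i : (<< i >> \in @supported F K P) = P i.
Proof.
apply/allP/idP => [|Pi j]; last by rewrite msuppU oner_eq0 inE => /eqP->.
by apply; rewrite msuppU oner_eq0 inE.
Qed.

End LinearExtension.

Section Brackets.
Variable F : numFieldType.
Local Notation kL n := (@kL F n).
Local Notation kG n := (@kG F n).
Implicit Types (n m k : int) (e : bool).

Definition ta k e : laurent F := << (k, e) >>.

Lemma lmul_linear (a : laurent F) : linear (lmul a).
Proof.
move=> c x y; rewrite /lmul /bilext /lext scaler_sumr -big_split /=.
apply: eq_bigr => i _; have := lext_linear (fun j =>
  if i.2 && j.2 then 0 else << (i.1 + j.1, i.2 || j.2) >> : laurent F) c x y.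
by rewrite /lext => ->; rewrite scalerDr !scalerA mulrC.
Qed.
HB.instance Definition _ (a : laurent F) :=
  GRing.isLinear.Build F (laurent F) (laurent F) *:%R (lmul a) (lmul_linear a).

Lemma lmul_ta k e m e' :
  lmul (ta k e) (ta m e') = if e && e' then 0 else ta (k + m) (e || e').
Proof. by rewrite /lmul /bilext !lextU. Qed.

Lemma lmul0 (a : laurent F) : lmul a 0 = 0.
Proof. exact: linear0. Qed.

Lemma lmulZ (c : F) (a x : laurent F) : lmul a (c *: x) = c *: lmul a x.
Proof. exact: linearZ_LR. Qed.

Lemma dt_ta k e : dt (ta k e) = k%:~R *: ta (k - 1) e.
Proof. by rewrite /dt lextU. Qed.

Lemma dxi_ta k e : dxi (ta k e) = if e then ta k false else 0.
Proof. by rewrite /dxi lextU. Qed.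

Lemma kact_L n k e : kact (kL n) (ta k e)
  = (k%:~R + e%:R * (n + 1)%:~R / 2) *: ta (n + k) e.
Proof.
rewrite /kact lextU /= -/(ta k e) -/(ta (n + 1) false) dt_ta dxi_ta lmulZ lmul_ta /=
  addrA (addrAC n) addrK.
case: e => /=; last by rewrite !lmul0 scaler0 addr0 !mul0r addr0.
by rewrite !lmul_ta /= add0r -scalerDl mul1r mulrC [(n + 1)%:~R * _]mulrC.
Qed.

Lemma kact_G n k e : kact (kG n) (ta k e)
  = if e then - ta (n + k + 1) false else k%:~R *: ta (n + k) true.
Proof.
rewrite /kact lextU /= -/(ta k e) -/(ta (n + 1) false) dt_ta dxi_ta !lmulZ lmul_ta /=.
case: e; last by rewrite lmul0 subr0 lmul_ta /= add0r addrA (addrAC n) addrK.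
by rewrite lmul0 scaler0 sub0r lmul_ta /= addrAC.
Qed.

Lemma kact0r u : kact u 0 = 0 :> laurent F.
Proof.
apply: lext_eq0 => -[[] n] /=; rewrite /dt /dxi !lext0 !lmul0 ?subr0 //.
by rewrite scaler0 addr0.
Qed.

Lemma homog_part0 (K : choiceType) (d : K -> bool) p : homog_part d p 0 = 0 :> {malg F[K]}.
Proof. exact: lext0. Qed.

Lemma ktilde_bracket_k (u v : kalg F) : ktilde_bracket (u, 0) (v, 0) = (kbracket u v, 0).
Proof.
rewrite /ktilde_bracket /= kact0r big1 ?subr0 // => p _; rewrite big1 // => q _.
by rewrite !homog_part0 kact0r scaler0.
Qed.

(** The second term of the bracket involves only the components [a] of the left
    factor and [v] of the right one, both zero here; hence no sign appears. *)
Lemma ktilde_bracket_A (u : kalg F) (a : laurent F) :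
  ktilde_bracket (u, 0) (0, a) = (0, kact u a).
Proof.
rewrite /ktilde_bracket /= [kbracket _ _]lext_eq0 => [|i]; last exact: lext0.
rewrite big1 ?subr0 // => p _; rewrite big1 // => q _.
by rewrite !homog_part0 kact0r scaler0.
Qed.

Lemma kbracketU i j : kbracket << i >> << j >> =
  match i.1, j.1 with
  | false, false => (j.2 - i.2)%:~R *: kL (i.2 + j.2)
  | false, true => (j.2%:~R + 2^-1 - i.2%:~R / 2) *: kG (i.2 + j.2)
  | true, false => - (i.2%:~R + 2^-1 - j.2%:~R / 2) *: kG (i.2 + j.2)
  | true, true => (- 2) *: kL (i.2 + j.2 + 1)
  end.
Proof. by rewrite /kbracket /bilext !lextU. Qed.

End Brackets.

(** * Relations between the operators of a module *)
Section Restriction.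
Variable F : numFieldType.
Implicit Types (g : {pred kalg F}) (A : {pred laurent F}) (M : superrep F).

Lemma is_module_sub (S S' : {pred ktilde F}) M :
  {subset S' <= S} -> is_module S M -> is_module S' M.
Proof.
move=> sub [par_s par_d par_i actl actr actp actb]; split=> //.
- by move=> c X Y v /sub SX /sub SY; apply: actl.
- by move=> c X v w /sub SX; apply: actr.
- by move=> p q X v /sub SX; apply: actp.
- by move=> p q X Y v /sub SX /sub SY; apply: actb.
Qed.

Lemma is_Ag_module_sub g g' A A' M : {subset g' <= g} -> {subset A' <= A} ->
  is_Ag_module g A M -> is_Ag_module g' A' M.
Proof.
move=> sub_g sub_A [mod assoc unit]; split=> //.
  by apply: is_module_sub mod => X /andP[/sub_g gX /sub_A AX]; apply/andP.
by move=> a b v /sub_A Aa /sub_A Ab; apply: assoc.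
Qed.

End Restriction.

(** The three algebras are treated together: [pg] selects the indices [n] of the
    allowed [L_n] and [G_(n + 1/2)], and [pa] the allowed exponents of [t]. *)
Definition on_k (pg : pred int) : pred (bool * int) := fun i => pg i.2.
Definition on_A (pa : pred int) : pred (int * bool) := fun i => pa i.1.
Notation gsub F pg := (@supported F _ (on_k pg)).
Notation Asub F pa := (@supported F _ (on_A pa)).

Section GradedModule.
Variables (F : numFieldType) (pg pa : pred int) (M : superrep F).
Hypothesis HM : is_Ag_module (gsub F pg) (Asub F pa) M.
Local Notation S := (semidirect (gsub F pg) (Asub F pa)).
Local Notation L n := (@act F M (@kL F n, 0)).
Local Notation G n := (@act F M (@kG F n, 0)).
Local Notation A k e := (@act F M (0, @ta F k e)).
Implicit Types (n m k j : int) (e : bool) (v w : M).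

Let mod_M : is_module S M. Proof. by case: HM. Qed.

Lemma in_semidirect g A u a : ((u, a) \in @semidirect F g A) = (u \in g) && (a \in A).
Proof. by []. Qed.
Lemma S_k i : pg i.2 -> (<< i >>, 0) \in S.
Proof. by move=> pgi; rewrite in_semidirect supportedU /on_k pgi rpred0. Qed.
Lemma S_A i : pa i.1 -> (0, << i >>) \in S.
Proof. by move=> pai; rewrite in_semidirect supportedU /on_A pai rpred0. Qed.
Lemma S_L n : pg n -> (@kL F n, 0) \in S. Proof. exact: (@S_k (false, n)). Qed.
Lemma S_G n : pg n -> (@kG F n, 0) \in S. Proof. exact: (@S_k (true, n)). Qed.
Lemma S_ta k e : pa k -> (0, @ta F k e) \in S. Proof. exact: (@S_A (k, e)). Qed.
Lemma S_0 : 0 \in S.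
Proof. by rewrite in_semidirect !rpred0. Qed.

Lemma S_lin c X Y : X \in S -> Y \in S -> c *: X + Y \in S.
Proof.
case: X Y => u a [u' a']; rewrite !in_semidirect => /andP[uS aS] /andP[u'S a'S].
by apply/andP; split; apply: rpredD => //; apply: rpredZ.
Qed.

Lemma act0 v : act 0 v = 0 :> M.
Proof.
have := act_linearl mod_M 1 v S_0 S_0.
by rewrite scaler0 add0r scale1r => /(congr1 (fun w => w - act 0 v)); rewrite subrr addrK.
Qed.

Lemma act_scale c X v : X \in S -> act (c *: X) v = c *: act X v :> M.
Proof.
by move=> SX; have := act_linearl mod_M c v SX S_0; rewrite !addr0 act0 addr0.
Qed.

Lemma actZ (c : F) X v : (c != 0 -> X \in S) -> act (c *: X) v = c *: act X v :> M.
Proof.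
have [-> _|nz /(_ isT)] := eqVneq c 0; last exact: act_scale.
by rewrite !scale0r act0.
Qed.

Lemma act_is_linear X : X \in S -> linear (@act F M X).
Proof. by move=> SX c v w; apply: (act_linearr mod_M). Qed.

Definition act_lin X (SX : X \in S) : {linear M -> M} :=
  HB.pack (@act F M X) (GRing.isLinear.Build F M M *:%R (@act F M X) (act_is_linear SX)).

Lemma homog_L n : (@kL F n, 0) \in @ktilde_homog F false.
Proof. by rewrite unfold_in /= (homogU F fst (false, n)) homog0. Qed.
Lemma homog_G n : (@kG F n, 0) \in @ktilde_homog F true.
Proof. by rewrite unfold_in /= (homogU F fst (true, n)) homog0. Qed.
Lemma homog_ta k e : (0, @ta F k e) \in @ktilde_homog F e.
Proof. by rewrite unfold_in /= (homogU F snd (k, e)) homog0. Qed.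

Lemma scale_k (c : F) (u : kalg F) : (c *: u, 0) = c *: (u, 0) :> ktilde F.
Proof. by congr pair; rewrite /= scaler0. Qed.
Lemma scale_A (c : F) (a : laurent F) : (0, c *: a) = c *: (0, a) :> ktilde F.
Proof. by congr pair; rewrite /= scaler0. Qed.

(** In these relations an element outside the subalgebra may occur with the
    coefficient zero, as [L_(-2)] in the bracket of [L_(-1)] with itself; its
    membership is required only when the coefficient is not zero. *)
Lemma act_LL n m v : pg n -> pg m -> (n != m -> pg (n + m)) ->
  L n (L m v) = L m (L n v) + (m - n)%:~R *: L (n + m) v.
Proof.
move=> pn pm pnm.
have := act_bracket mod_M v (S_L pn) (S_L pm) (homog_L n) (homog_L m).
rewrite ktilde_bracket_k kbracketU /= scale_k actZ; last first.
  by rewrite intr_eq0 subr_eq0 eq_sym => /pnm; apply: S_L.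
by rewrite expr0 scale1r => ->; rewrite addrCA subrr addr0.
Qed.

Lemma act_LG n m v : pg n -> pg m ->
    (m%:~R + 2^-1 - n%:~R / 2 != 0 :> F -> pg (n + m)) ->
  L n (G m v) = G m (L n v) + (m%:~R + 2^-1 - n%:~R / 2) *: G (n + m) v.
Proof.
move=> pn pm pnm.
have := act_bracket mod_M v (S_L pn) (S_G pm) (homog_L n) (homog_G m).
rewrite ktilde_bracket_k kbracketU /= scale_k actZ; last by move=> /pnm; apply: S_G.
by rewrite expr0 scale1r => ->; rewrite addrCA subrr addr0.
Qed.

Lemma act_GG n m v : pg n -> pg m -> pg (n + m + 1) ->
  G n (G m v) = - G m (G n v) - 2 *: L (n + m + 1) v.
Proof.
move=> pn pm pnm.
have := act_bracket mod_M v (S_G pn) (S_G pm) (homog_G n) (homog_G m).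
rewrite ktilde_bracket_k kbracketU /= scale_k actZ; last by move=> _; apply: S_L.
by rewrite expr1 scaleN1r opprK -scaleNr => ->; rewrite addrCA addNr addr0.
Qed.

Lemma act_LA n k e v : pg n -> pa k ->
    (k%:~R + e%:R * (n + 1)%:~R / 2 != 0 :> F -> pa (n + k)) ->
  L n (A k e v) = A k e (L n v) + (k%:~R + e%:R * (n + 1)%:~R / 2) *: A (n + k) e v.
Proof.
move=> pn pk pnk.
have := act_bracket mod_M v (S_L pn) (S_ta e pk) (homog_L n) (homog_ta k e).
rewrite ktilde_bracket_A kact_L scale_A actZ; last by move=> /pnk; apply: S_ta.
by rewrite expr0 scale1r => ->; rewrite addrCA subrr addr0.
Qed.

Lemma act_GA0 n k v : pg n -> pa k -> (k != 0 -> pa (n + k)) ->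
  G n (A k false v) = A k false (G n v) + k%:~R *: A (n + k) true v.
Proof.
move=> pn pk pnk.
have := act_bracket mod_M v (S_G pn) (S_ta false pk) (homog_G n) (homog_ta k false).
rewrite ktilde_bracket_A kact_G /= scale_A actZ; last first.
  by rewrite intr_eq0 => /pnk; apply: S_ta.
by rewrite expr0 scale1r => ->; rewrite addrCA subrr addr0.
Qed.

Lemma act_GA1 n k v : pg n -> pa k -> pa (n + k + 1) ->
  G n (A k true v) = - A k true (G n v) - A (n + k + 1) false v.
Proof.
move=> pn pk pnk.
have := act_bracket mod_M v (S_G pn) (S_ta true pk) (homog_G n) (homog_ta k true).
rewrite ktilde_bracket_A kact_G /= -[- ta _ _ _]scaleN1r scale_A actZ;
  last by move=> _; apply: S_ta.
by rewrite expr1 !scaleN1r opprK => ->; rewrite addrCA addNr addr0.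
Qed.

Lemma act_AA k j e e' v : pa k -> pa j ->
  A k e (A j e' v) = if e && e' then 0 else A (k + j) (e || e') v.
Proof.
move=> pk pj; have [_ assoc _] := HM.
rewrite -assoc ?supportedU // lmul_ta; case: ifP => // _.
exact: act0.
Qed.

Lemma act_xi_t k v : pa 0 -> pa k -> A 0 true (A k false v) = A k true v.
Proof. by move=> p0 pk; rewrite act_AA // add0r. Qed.

Lemma act_t0 v : A 0 false v = v.
Proof. by have [_ _] := HM; apply. Qed.

Lemma par_act_L n p v : pg n -> v \in par p -> L n v \in @par F M p.
Proof. by move=> pn; apply: act_par (S_L pn) (homog_L n). Qed.
Lemma par_act_G n p v : pg n -> v \in par p -> G n v \in @par F M (~~ p).
Proof. by move=> pn; apply: act_par (S_G pn) (homog_G n). Qed.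
Lemma par_act_A k e p v : pa k -> v \in par p -> A k e v \in @par F M (e (+) p).
Proof. by move=> pk; apply: act_par (S_ta e pk) (homog_ta k e). Qed.

Lemma act_sum (I : eqType) (s : seq I) (c : I -> F) (X : I -> ktilde F) v :
    {in s, forall i, X i \in S} ->
  \sum_(i <- s) c i *: X i \in S /\
  act (\sum_(i <- s) c i *: X i) v = \sum_(i <- s) c i *: @act F M (X i) v.
Proof.
elim: s => [|i s IH] SX; first by rewrite !big_nil; split; [exact: S_0|exact: act0].
have [Ss act_s] := IH (fun l ls => SX l (mem_behead (s := i :: s) ls)).
have Si := SX i (mem_head _ _).
by rewrite !big_cons (act_linearl mod_M) // act_s; split=> //; apply: S_lin.
Qed.

(** An element of the subalgebra is a combination of basis elements of the
    subalgebra, so it acts as the corresponding combination. *)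
Lemma act_lext u a v :
  (u, a) \in S -> @act F M (u, a) v
    = lext (fun i => act (<< i >>, 0) v) u + lext (fun i => act (0, << i >>) v) a.
Proof.
rewrite in_semidirect => /andP[/allP Su /allP Sa].
have [Suu act_u] := @act_sum _ (msupp u) (mcoeff^~ u) (fun i => (<< i >>, 0)) v
  (fun i iu => S_k (Su i iu)).
have [Saa act_a] := @act_sum _ (msupp a) (mcoeff^~ a) (fun i => (0, << i >>)) v
  (fun i ia => S_A (Sa i ia)).
have uE : (u, 0) = \sum_(i <- msupp u) u@_i *: (<< i >>, 0) :> ktilde F.
  rewrite -{1}(lext_basis u) (big_morph (fun x => (x, 0) : ktilde F)
    (id1 := 0) (op1 := +%R)) => [|x y|//].
    by apply: eq_bigr => i _; rewrite scale_k.
  by congr pair; rewrite addr0.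
have aE : (0, a) = \sum_(i <- msupp a) a@_i *: (0, << i >>) :> ktilde F.
  rewrite -{1}(lext_basis a) (big_morph (fun x => (0, x) : ktilde F)
    (id1 := 0) (op1 := +%R)) => [|x y|//].
    by apply: eq_bigr => i _; rewrite scale_A.
  by congr pair; rewrite addr0.
have -> : (u, a) = 1 *: (u, 0) + (0, a) :> ktilde F.
  by rewrite scale1r; congr pair; rewrite /= ?addr0 ?add0r.
rewrite (act_linearl mod_M) ?scale1r; first by rewrite uE aE act_u act_a.
  by rewrite uE.
by rewrite aE.
Qed.

End GradedModule.

(** * Families of densities and equivariance *)
Lemma rpred_lext (F : fieldType) (K : choiceType) (V : lmodType F) (N : submodClosed V)
    (f : K -> V) (y : {malg F[K]}) :
  (forall i, i \in msupp y -> f i \in N) -> lext f y \in N.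
Proof.
by move=> Nf; rewrite /lext big_seq; apply: rpred_sum => i /Nf; apply: rpredZ.
Qed.

Lemma eq_addr_sub (V : zmodType) (x y z : V) : x = y + z -> y = x - z.
Proof. by move=> ->; rewrite addrK. Qed.

Lemma eq_addl_sub (V : zmodType) (x y z : V) : x = y + z -> z = x - y.
Proof. by move=> ->; rewrite addrC addKr. Qed.

Lemma eq_lext (F : fieldType) (K : choiceType) (V : lmodType F) (f g : K -> V)
    (y : {malg F[K]}) : f =1 g -> lext f y = lext g y.
Proof. by move=> eq_fg; apply: eq_bigr => i _; rewrite eq_fg. Qed.

Lemma lmul_bilext (F : numFieldType) (a y : laurent F) :
  lmul a y = lext (fun i => lext (fun j => lmul << i >> << j >>) y) a.
Proof. by apply: eq_lext => i; apply: eq_lext => j; rewrite /lmul /bilext !lextU. Qed.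

Lemma submod_closed_sum (F : fieldType) (V : lmodType F) (N : {pred V}) (I : eqType)
    (s : seq I) (c : I -> F) (f : I -> V) :
  submod_closed N -> {in s, forall i, f i \in N} -> \sum_(i <- s) c i *: f i \in N.
Proof.
move=> [N0 Nlin]; elim: s => [|i s IH] Nf; first by rewrite big_nil.
rewrite big_cons; apply: Nlin; first by rewrite Nf ?mem_head.
by apply: IH => j js; apply: Nf; rewrite inE js orbT.
Qed.

Section HomogeneousParts.
Variables (F : fieldType) (K : choiceType) (d : K -> bool).
Implicit Types y : {malg F[K]}.

Lemma homog_partE p y :
  homog_part d p y = \sum_(i <- msupp y) y@_i *: (if d i == p then << i >> else 0).
Proof. by []. Qed.

Lemma homog_part_homog p y : homog_part d p y \in homog d p.
Proof.
suff: homog_part d p y \in supported (fun i => d i == p) by [].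
apply: rpred_lext => i _; case: ifP => di; last exact: rpred0.
by rewrite supportedU.
Qed.

Lemma homog_part_supported (Q : pred K) p y :
  y \in supported Q -> homog_part d p y \in supported Q.
Proof.
move=> /allP Qy; apply: rpred_lext => i /Qy Qi.
by case: ifP => _; rewrite ?supportedU ?rpred0.
Qed.

Lemma homog_part_sum y : y = homog_part d false y + homog_part d true y.
Proof.
rewrite -{1}(lext_basis y) !homog_partE -big_split; apply: eq_bigr => i _ /=.
by rewrite -scalerDr; case: (d i); rewrite ?add0r ?addr0.
Qed.

End HomogeneousParts.

(** The vectors [x k], [k] in [P], satisfy the formulas of [t^k] in
    [Gamma (lam, b)] for the generators [t^j], [L_(-1)], ..., [L_2], [G_(-1/2)], and
    [L_(-2)] if it is in the algebra. In the applications [P] consists of all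
    integers, or of the nonnegative ones with [lam = 0], when [L_(-1)]
    annihilates [x 0] ([df_P_down]). *)
Record density_family (F : numFieldType) (M : superrep F) (pg pa P : pred int)
    (lam b : F) (x : int -> M) : Prop := DensityFamily {
  df_pgN1 : forall n, -1 <= n -> pg n;
  df_pa0 : forall k, 0 <= k -> pa k;
  df_pgS : forall n, pg n -> n != -2 -> pg (n + 1);
  df_pg_pa : forall n, pg n -> n != -1 -> pa n;
  df_pg_pa1 : forall n, pg n -> pa (n + 1);
  df_P_pa : forall k j, P k -> pa j -> P (k + j);
  df_P_down : forall k, P k -> P (k - 1) \/ lam + k%:~R = 0;
  df_A : forall k j, P k -> pa j -> @act F M (0, @ta F j false) (x k) = x (k + j);
  df_Lsmall : forall n k, -1 <= n <= 2 -> P k ->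
    @act F M (@kL F n, 0) (x k) = (lam + k%:~R + b * (n + 1)%:~R) *: x (n + k);
  df_Gm : forall k, P k -> @act F M (@kG F (-1), 0) (x k)
    = (lam + k%:~R) *: @act F M (0, @ta F 0 true) (x (k - 1));
  df_low : (forall n, pg n -> -1 <= n) \/
    [/\ forall n, pg n, forall k, P k &
        forall k, @act F M (@kL F (-2), 0) (x k)
          = (lam + k%:~R + b * (-2 + 1)%:~R) *: x (-2 + k)]
}.

Section DensityFamily.
Variables (F : numFieldType) (pg pa P : pred int) (M : superrep F).
Hypothesis HM : is_Ag_module (gsub F pg) (Asub F pa) M.
Local Notation S := (semidirect (gsub F pg) (Asub F pa)).
Local Notation L n := (@act F M (@kL F n, 0)).
Local Notation G n := (@act F M (@kG F n, 0)).
Local Notation A k e := (@act F M (0, @ta F k e)).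
Variables (lam b : F) (x : int -> M).
Hypothesis fam : density_family pg pa P lam b x.

Let pgN1 := df_pgN1 fam.
Let pa0 := df_pa0 fam.
Let pgS := df_pgS fam.
Let pg_pa := df_pg_pa fam.
Let pg_pa1 := df_pg_pa1 fam.
Let P_pa := df_P_pa fam.
Let P_down := df_P_down fam.
Let x_A := df_A fam.
Let x_Lsmall := df_Lsmall fam.
Let x_Gm := df_Gm fam.
Let x_low := df_low fam.

Lemma act_vZ X (c : F) (v : M) : X \in S -> act X (c *: v) = c *: act X v.
Proof. by move=> SX; apply: (linearZ_LR (act_lin HM SX)). Qed.

Let SL n (pn : pg n) := S_L F pa pn.
Let SG n (pn : pg n) := S_G F pa pn.

Lemma P_add n k : pg n -> n != -1 -> P k -> P (n + k).
Proof. by move=> pn n1 Pk; rewrite addrC; apply: P_pa (pg_pa pn n1). Qed.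

(** The bracket of [L_1] and [L_n] is [(n - 1) L_(n + 1)], so [L_1] and [L_2] give all
    higher [L_n]. *)
Lemma family_L_up (n : nat) k : P k ->
  L n (x k) = (lam + k%:~R + b * (n%:Z + 1)%:~R) *: x (n%:Z + k).
Proof.
elim: n k => [|n IH] k Pk; first by apply: x_Lsmall.
have [le_n1|lt_1n] := leqP n 1; first by apply: x_Lsmall => //; lia.
have pn : pg n by apply: pgN1; lia.
have p1 : pg 1 by apply: pgN1.
have nz : (n%:Z - 1)%:~R != 0 :> F by rewrite intr_eq0; lia.
have p1n : pg (1 + n%:Z) by apply: pgN1; lia.
have Pnk : P (n%:Z + k) by apply: P_add => //; lia.
have P1k : P (1 + k) by apply: P_add.
have L1Ln : L 1 (L n (x k)) = (lam + k%:~R + b * (n%:Z + 1)%:~R) *: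
    ((lam + (n%:Z + k)%:~R + b * (1 + 1)%:~R) *: x (n.+1%:Z + k)).
  rewrite (IH _ Pk) (act_vZ _ _ (SL p1)) (x_Lsmall _ Pnk) //.
  by rewrite addrA -intS.
have LnL1 : L n (L 1 (x k)) = (lam + k%:~R + b * (1 + 1)%:~R) *:
    ((lam + (1 + k)%:~R + b * (n%:Z + 1)%:~R) *: x (n.+1%:Z + k)).
  rewrite (x_Lsmall _ Pk) // (act_vZ _ _ (SL pn)) (IH _ P1k).
  by rewrite addrCA addrA -intS.
apply: (scalerI nz); have /eq_addl_sub := act_LL HM (x k) p1 pn (fun _ => p1n).
rewrite -intS L1Ln LnL1 => ->.
by rewrite intS !rmorphD /=; lmod.
Qed.

(** Downwards, the bracket of [L_(-1)] and [L_n] is [(n + 1) L_(n - 1)], so [L_(-1)]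
    and [L_(-2)] give all lower [L_n]. *)
Lemma family_L n k : pg n -> P k ->
  L n (x k) = (lam + k%:~R + b * (n + 1)%:~R) *: x (n + k).
Proof.
case: n => n pn Pk; first exact: family_L_up.
case: x_low => [ge_N1|[pg_all P_all x_Lmm]].
  by case: n pn => [|n] pn; [apply: x_Lsmall | have := ge_N1 _ pn].
elim: n {pn Pk} k => [|[|n] IH] k; [exact: x_Lsmall | exact: x_Lmm |].
set m : int := Negz n.+1 in IH *.
have -> : Negz n.+2 = -1 + m by rewrite /m; lia.
have nz : (m - -1)%:~R != 0 :> F by rewrite intr_eq0 /m; lia.
apply: (scalerI nz).
have /eq_addl_sub -> := act_LL HM (x k) (pg_all (-1)) (pg_all m) (fun _ => pg_all _).
rewrite IH (act_vZ _ _ (SL (pg_all _))) !x_Lsmall // (act_vZ _ _ (SL (pg_all _))) IH.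
rewrite (addrCA m) -!(addrA (-1)).
by rewrite !rmorphD rmorphN1 /=; lmod.
Qed.

Lemma family_L_xi n k : pg n -> P k -> L n (A 0 true (x k))
  = (lam + k%:~R + (n + 1)%:~R * (b + 2^-1)) *: A 0 true (x (n + k)).
Proof.
move=> pn Pk; have coefE : 0%:~R + true%:R * (n + 1)%:~R / 2 = (n + 1)%:~R / 2 :> F.
  by rewrite add0r mul1r.
have pa00 : pa 0 by apply: pa0.
have [n1|n1] := eqVneq n (-1).
  rewrite (act_LA HM _ pn pa00); last by rewrite coefE n1 addNr mul0r eqxx.
  rewrite coefE family_L // (act_vZ _ _ (S_ta F pg true (pa0 _))) // n1.
  by rewrite addNr !mul0r scale0r mulr0 !addr0.
have pan := pg_pa pn n1.
rewrite (act_LA HM _ pn pa00); last by rewrite addr0.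
rewrite coefE addr0 family_L // (act_vZ _ _ (S_ta F pg true (pa0 _))) //.
have -> : A n true (x k) = A 0 true (x (n + k)).
  by rewrite (addrC n) -x_A // (act_xi_t HM _ (pa0 _) pan).
by lmod.
Qed.

(** The bracket of [L_(n + 1)] with [G_(-1/2)] is [- (n + 2) / 2] times
    [G_(n + 1/2)]. For [n = -2] this is zero, and [G_(-3/2)] is obtained from [L_(-2)]
    and [G_(1/2)] instead. *)
Lemma family_G n k : pg n -> P k ->
  G n (x k) = (k%:~R + lam + 2 * b * (n + 1)%:~R) *: A 0 true (x (n + k)).
Proof.
have Gm_x j : P j -> G (-1) (x j) = (lam + j%:~R) *: A 0 true (x (j - 1)) by apply: x_Gm.
have pN1 : pg (-1) by apply: pgN1.
have G_x (j m : int) : m != -2 -> pg m -> P j ->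
    G m (x j) = (j%:~R + lam + 2 * b * (m + 1)%:~R) *: A 0 true (x (m + j)).
  move: j m => {}k {}n n2 pn Pk; have [->|n1] := eqVneq n (-1).
    by rewrite Gm_x // addNr mulr0 addr0 addrC (addrC (-1)).
  have pn1 := pgS pn n2.
  have n1N : n + 1 != -1 by lia.
  have Pn1k : P (n + 1 + k) by apply: P_add.
  have nz : (-1)%:~R + 2^-1 - (n + 1)%:~R / 2 != 0 :> F.
    rewrite (_ : _ - _ = - (n + 2)%:~R / 2); last by rewrite !rmorphD rmorphN1; field.
    by rewrite mulf_neq0 ?invr_eq0 ?oppr_eq0 ?intr_eq0 ?pnatr_eq0 //; lia.
  have nE : n + 1 + -1 = n by lia.
  have Gm_L : G (-1) (L (n + 1) (x k)) = (lam + k%:~R + b * (n + 1 + 1)%:~R) *: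
      ((lam + (n + 1 + k)%:~R) *: A 0 true (x (n + k))).
    rewrite (family_L pn1 Pk) (act_vZ _ _ (SG pN1)) Gm_x //.
    by rewrite (_ : n + 1 + k - 1 = n + k) //; lia.
  have L_Gm : L (n + 1) (G (-1) (x k)) = (lam + k%:~R) *:
      ((lam + (k - 1)%:~R + (n + 1 + 1)%:~R * (b + 2^-1)) *: A 0 true (x (n + k))).
    rewrite (Gm_x _ Pk) (act_vZ _ _ (SL pn1)).
    have [Pk1|->] := P_down Pk; last by rewrite !scale0r.
    by rewrite family_L_xi // (_ : n + 1 + (k - 1) = n + k) //; lia.
  apply: (scalerI nz).
  have := act_LG HM (x k) pn1 pN1; rewrite nE => /(_ (fun _ => pn)) /eq_addl_sub ->.
  rewrite Gm_L L_Gm.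
  by rewrite !rmorphD rmorphN1; lmod.
move=> pn Pk; have [n2|n2] := eqVneq n (-2); last exact: G_x.
case: x_low => [/(_ _ pn)|[pg_all P_all _]]; first by rewrite n2.
have G0_L : G 0 (L (-2) (x k)) = (lam + k%:~R + b * (-2 + 1)%:~R) *:
    (((-2 + k)%:~R + lam + 2 * b * (0 + 1)%:~R) *: A 0 true (x (-2 + k))).
  by rewrite family_L // (act_vZ _ _ (SG (pg_all _))) G_x // (add0r (-2 + k)).
have L_G0 : L (-2) (G 0 (x k)) = (k%:~R + lam + 2 * b * (0 + 1)%:~R) *:
    ((lam + k%:~R + (-2 + 1)%:~R * (b + 2^-1)) *: A 0 true (x (-2 + k))).
  by rewrite G_x // (add0r k) (act_vZ _ _ (SL (pg_all _))) family_L_xi.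
have nz : 0%:~R + 2^-1 - (-2)%:~R / 2 != 0 :> F.
  by rewrite (_ : _ - _ = 3 / 2) ?mulf_neq0 ?invr_eq0 ?pnatr_eq0 //; field.
rewrite n2; apply: (scalerI nz).
have /eq_addl_sub := act_LG HM (x k) (pg_all (-2)) (pg_all 0) (fun _ => pg_all _).
rewrite addr0 => ->; rewrite G0_L L_G0.
by rewrite !rmorphD /=; lmod.
Qed.

Definition family_map : laurent F -> M :=
  lext (fun i => if i.2 then A 0 true (x i.1) else x i.1).

Lemma family_map_linear : linear family_map.
Proof. exact: lext_linear. Qed.
HB.instance Definition _ :=
  GRing.isLinear.Build F (laurent F) M *:%R family_map family_map_linear.

Let f_Z c (y : laurent F) : family_map (c *: y) = c *: family_map y.
Proof. exact: linearZ_LR. Qed.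
Let f_ta k e : family_map (ta F k e) = if e then A 0 true (x k) else x k.
Proof. exact: lextU. Qed.

Lemma family_map_basis_k i j : pg i.2 -> P j.1 ->
  family_map (Gamma_basis_act lam b i j) = act (<< i >>, 0) (family_map << j >>).
Proof.
case: i j => [[] n] [k []] /= pn Pk; rewrite /Gamma_basis_act /=.
- rewrite -/(ta F (n + k + 1) false) -scaleN1r f_Z !f_ta scaleN1r.
  have pa00 : pa 0 by apply: pa0.
  have pn1 : pa (n + 0 + 1) by rewrite addr0; apply: pg_pa1.
  rewrite (act_GA1 HM _ pn pa00 pn1) family_G // (act_vZ _ _ (S_ta F pg true pa00)).
  rewrite (act_AA HM _ _ _ pa00 pa00) scaler0 oppr0 add0r x_A //.
  by congr (- x _); lia.
- by rewrite f_Z !f_ta family_G.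
- by rewrite f_Z !f_ta family_L_xi.
- by rewrite f_Z !f_ta family_L.
Qed.

Lemma family_map_basis_A i j : pa i.1 -> P j.1 ->
  family_map (lmul << i >> << j >>) = act (0, << i >>) (family_map << j >>).
Proof.
case: i j => [m e] [k e'] /= pm Pk.
have f0 : family_map 0 = 0 by apply: linear0.
have pa00 : pa 0 by apply: pa0.
rewrite (lmul_ta F m e k e') !f_ta; case: e e' => [] [] /=.
- by rewrite f0 (act_AA HM _ _ _ pm pa00).
- by rewrite f_ta addrC -(x_A Pk pm) (act_xi_t HM _ pa00 pm).
- rewrite f_ta (act_AA HM _ _ _ pm pa00) /= addr0 -(act_xi_t HM _ pa00 pm) //.
  by rewrite (x_A Pk pm) addrC.
- by rewrite f_ta x_A // addrC.
Qed.

(** Both sides are bilinear, so that basis elements suffice. *)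
Lemma family_map_act X y : X \in S -> y \in supported (on_A P) ->
  family_map (Gamma_act lam b X y) = act X (family_map y).
Proof.
case: X => u a SX /allP Py; have /andP[/= /allP Su /allP Sa] := SX.
have fD y1 y2 : family_map (y1 + y2) = family_map y1 + family_map y2 by apply: linearD.
have f_sum (I : eqType) (s : seq I) (c : I -> F) z :
    family_map (\sum_(i <- s) c i *: z i) = \sum_(i <- s) c i *: family_map (z i).
  by rewrite [LHS]linear_sum; apply: eq_bigr => i _; apply: f_Z.
have act_y Y : Y \in S -> act Y (family_map y) =
    \sum_(j <- msupp y) y@_j *: act Y (family_map << j >>).
  move=> SY; rewrite -[in LHS](lext_basis y) f_sum.
  rewrite -[act Y _]/(act_lin HM SY _) linear_sum; apply: eq_bigr => j _.
  exact: linearZ_LR.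
rewrite (act_lext HM) // /Gamma_act fD /= lmul_bilext /bilext !f_sum; congr (_ + _).
  rewrite /lext !big_seq; apply: eq_bigr => i /Su pi.
  rewrite f_sum act_y ?(S_k F pa) //; congr (_ *: _).
  by rewrite !big_seq; apply: eq_bigr => j /Py Pj; rewrite family_map_basis_k.
rewrite /lext !big_seq; apply: eq_bigr => i /Sa pi.
rewrite f_sum act_y ?(S_A F pg) //; congr (_ *: _).
by rewrite !big_seq; apply: eq_bigr => j /Py Pj; rewrite family_map_basis_A.
Qed.

(** The only operators that could leave the span of the [t^k xi^e], [k] in [P], are
    [L_(-1)] and [G_(-1/2)] at the lowest [k], and there their coefficient
    [lam + k] vanishes. *)
Lemma Gamma_act_supported X y : X \in S -> y \in supported (on_A P) ->
  Gamma_act lam b X y \in supported (on_A P).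
Proof.
case: X => u a /andP[/= /allP Su /allP Sa] /allP Py.
have P_n k n : P k -> pg n -> P (n + k) \/ n = -1 /\ lam + k%:~R = 0.
  move=> Pk pn; have [->|n1] := eqVneq n (-1); last by left; apply: P_add.
  by rewrite addrC; have [|] := P_down Pk; [left|right].
have in_P (c : F) k e : P k -> c *: << (k, e) >> \in supported (on_A P).
  by move=> Pk; apply: rpredZ; rewrite supportedU.
rewrite /Gamma_act lmul_bilext; apply: rpredD; apply: rpred_lext => i.
  case: i => [c n] /Su pn; apply: rpred_lext => -[k e] /Py Pk.
  have Pnk1 : P (n + k + 1) by rewrite (_ : n + k + 1 = k + (n + 1)); [apply/P_pa/pg_pa1 | lia].
  rewrite /Gamma_basis_act /=; case: c e {pn Pk} (P_n k n Pk pn) => [] [] Pnk.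
  - by rewrite rpredN supportedU.
  - case: Pnk => [|[-> lam0]]; first exact: in_P.
    by rewrite (addrC k%:~R) lam0 addNr !mulr0 addr0 scale0r rpred0.
  - case: Pnk => [|[-> lam0]]; first exact: in_P.
    by rewrite lam0 addNr mul0r addr0 scale0r rpred0.
  - case: Pnk => [|[-> lam0]]; first exact: in_P.
    by rewrite lam0 addNr !mulr0 addr0 scale0r rpred0.
move=> /Sa pi; apply: rpred_lext => j /Py Pj.
case: i j pi Pj => [m e] [k e'] pm Pk; rewrite (lmul_ta F m e k e').
by case: ifP => _; rewrite ?rpred0 // supportedU /on_A /= addrC; apply: P_pa.
Qed.

Lemma family_map_weight k e : P k ->
  L 0 (family_map << (k, e) >>)
    = (lam + b + k%:~R + e%:R / 2) *: family_map << (k, e) >>.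
Proof.
move=> Pk; rewrite -[L 0 _]/(act (<< (false, 0) >>, 0) _).
rewrite -family_map_basis_k ?pgN1 // /Gamma_basis_act /=.
case: e; rewrite f_Z add0r add0r ?mulr1 ?mul1r; congr (_ *: _).
  by rewrite -!addrA; congr (_ + _); rewrite addrCA.
by rewrite mul0r addr0 addrAC.
Qed.

(** The images of distinct basis vectors have distinct weights. *)
Lemma family_map_coef_eq0 y i : y \in supported (on_A P) -> family_map y = 0 ->
  family_map << i >> != 0 -> y@_i = 0.
Proof.
move=> /allP Py fy0 nz_fi; have [iy|/mcoeff_outdom//] := boolP (i \in msupp y).
pose wt (j : int * bool) : F := lam + b + j.1%:~R + j.2%:R / 2.
have wt_f j : j \in msupp y -> act (@kL F 0, 0) (family_map << j >>) = wt j *: family_map << j >>.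
  by case: j => k e /Py Pk; apply: family_map_weight.
have wt_inj j : wt j = wt i -> j = i.
  case: j i {iy nz_fi} => [k e] [k' e'] /eqP.
  rewrite /wt /= -!addrA !(inj_eq (addrI _)) => /eqP eq_wt.
  have : (2 * k + e%:Z)%:~R = (2 * k' + e'%:Z)%:~R :> F.
    have := congr1 (fun c => 2 * c) eq_wt.
    by rewrite !mulrDr !(mulrCA 2) !divff ?pnatr_eq0 // !mulr1 !rmorphD !rmorphM.
  by move/eqP; rewrite eqr_int; case: e e' {eq_wt} => [] [] /= /eqP eq_k; congr pair; lia.
have fyE : family_map y = \sum_(j <- msupp y) y@_j *: family_map << j >>.
  rewrite -{1}(lext_basis y) [LHS]linear_sum; apply: eq_bigr => j _; exact: f_Z.
move: fy0; rewrite fyE (bigD1_seq i) //= => /eqP; rewrite addr_eq0 => /eqP fiE.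
have SL0 : (@kL F 0, 0) \in S by apply/SL/pgN1.
pose s := [seq y@_j *: family_map << j >> | j <- msupp y & j != i].
have sE : \sum_(w <- s) w = \sum_(j <- msupp y | j != i) y@_j *: family_map << j >>.
  by rewrite big_map big_filter.
have := @sum_eigenvectors_eq0 F M (act_lin HM SL0) (wt i) s.
rewrite sE => s0; move/eqP: (fiE); rewrite s0 ?oppr0 ?scaler_eq0 ?(negPf nz_fi) ?orbF.
- by move/eqP.
- move=> w /mapP[j]; rewrite mem_filter => /andP[ji jy] ->; exists (wt j).
    by apply: contra_neq ji => /wt_inj.
  by rewrite linearZ /= wt_f // scalerA mulrC -scalerA.
- have -> : \sum_(j <- msupp y | j != i) y@_j *: family_map << j >>
      = - (y@_i *: family_map << i >>) by rewrite fiE opprK.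
  by rewrite linearN linearZ /= wt_f // scalerN scalerA mulrC -scalerA.
Qed.

(** From [G_(-1/2) xi = - xi G_(-1/2) - 1], since [G_(-1/2) (x k)] lies in the image of
    [xi] and [xi] has square zero. *)
Lemma family_xi_neq0 k : P k -> x k != 0 -> A 0 true (x k) != 0.
Proof.
move=> Pk; apply: contraNneq => xi_x.
have pm : pg (-1) by apply: pgN1.
have pa00 : pa 0 by apply: pa0.
have act00 X : X \in S -> act X 0 = 0 :> M by move=> SX; apply: (linear0 (act_lin HM SX)).
have := act_GA1 HM (x k) pm pa00 (pa0 (lexx 0) : pa (-1 + 0 + 1)).
rewrite xi_x (act00 _ (SG pm)) x_Gm // (act_vZ _ _ (S_ta F pg true pa00)).
rewrite (act_AA HM _ _ _ pa00 pa00) scaler0 oppr0 add0r x_A //.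
by rewrite !addr0 => /esym/eqP; rewrite oppr_eq0.
Qed.

Lemma family_map_basis_neq0 k e : P k -> x k != 0 -> family_map << (k, e) >> != 0.
Proof. by move=> Pk nz_x; rewrite f_ta; case: e => //; apply: family_xi_neq0. Qed.

Variable q : bool.
Hypothesis x_par : forall k, P k -> x k \in par q.

Let mod_M : is_module S M. Proof. by case: HM. Qed.

Lemma family_map_par p y : y \in supported (on_A P) -> y \in homog snd p ->
  family_map y \in par (p (+) q).
Proof.
move=> /allP Py /allP hy; apply: submod_closed_sum; first exact: par_submod mod_M _.
move=> [k e] ky; have Pk := Py _ ky; have /eqP /= <- := hy _ ky.
case: e {ky Pk} (Pk : P k) => Pk /=; last exact: x_par.
by have := par_act_A HM true (pa0 (lexx 0)) (x_par Pk).
Qed.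

(** The image is a nonzero graded submodule of a simple module. *)
Lemma family_map_surj k0 : simple S M -> P k0 -> x k0 != 0 ->
  forall v, exists2 y, y \in supported (on_A P) & v = family_map y.
Proof.
move=> [_ simpleM] Pk0 nz_x0.
pose N : {pred M} := fun v => `[< exists2 y, y \in supported (on_A P) & v = family_map y >].
have NP v : reflect (exists2 y, y \in supported (on_A P) & v = family_map y) (v \in N).
  exact: asboolP.
have subN : is_submodule S N.
  split.
  - split; first by apply/NP; exists 0; rewrite ?rpred0 // [RHS]linear0.
    move=> c _ _ /NP[y1 Py1 ->] /NP[y2 Py2 ->]; apply/NP; exists (c *: y1 + y2).
      by rewrite rpredD ?rpredZ.
    by rewrite [RHS]linearP.
  - move=> _ /NP[y Py ->]; have P_part p := homog_part_supported snd p Py.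
    have N_part p : family_map (homog_part snd p y) \in N.
      by apply/NP; exists (homog_part snd p y).
    have par_part p := family_map_par (P_part p) (homog_part_homog snd p y).
    have fyE : family_map y = family_map (homog_part snd false y)
        + family_map (homog_part snd true y).
      by rewrite {1}(homog_part_sum snd y) [LHS]linearD.
    have := par_part false; have := par_part true; rewrite fyE.
    case: (q) => par1 par0.
      exists (family_map (homog_part snd true y)), (family_map (homog_part snd false y)).
      by split; [exact: N_part|exact: N_part|exact: par1|exact: par0|exact: addrC].
    exists (family_map (homog_part snd false y)), (family_map (homog_part snd true y)).
    by split; [exact: N_part|exact: N_part|exact: par0|exact: par1|].
  - move=> X _ SX /NP[y Py ->]; apply/NP; exists (Gamma_act lam b X y).
      exact: Gamma_act_supported.
    by rewrite family_map_act.
have [N0|Nall] := simpleM N subN; last by move=> v; apply/NP/Nall.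
case/eqP: nz_x0; apply: N0; apply/NP; exists (ta F k0 false).
  by rewrite supportedU.
by rewrite f_ta.
Qed.

End DensityFamily.

(** * Modules over the polynomial algebra *)
Definition pgplus : pred int := fun n => -1 <= n.
Definition paplus : pred int := fun k => 0 <= k.

Section PlusModule.
Variables (F : numFieldType) (M : superrep F).
Hypothesis HM : is_Ag_module (gsub F pgplus) (Asub F paplus) M.
Local Notation S := (semidirect (gsub F pgplus) (Asub F paplus)).
Local Notation L n := (@act F M (@kL F n, 0)).
Local Notation G n := (@act F M (@kG F n, 0)).
Local Notation A k e := (@act F M (0, @ta F k e)).

Let Llin n (pn : pgplus n) : {linear M -> M} := act_lin HM (S_L F paplus pn).
Let Glin n (pn : pgplus n) : {linear M -> M} := act_lin HM (S_G F paplus pn).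
Let Alin k e (pk : paplus k) : {linear M -> M} := act_lin HM (S_ta F pgplus e pk).

Lemma act_LA0 n k v : -1 <= n -> 0 <= k -> 0 <= n + k ->
  L n (A k false v) = A k false (L n v) + k%:~R *: A (n + k) false v.
Proof.
move=> n1 k0 nk; rewrite (act_LA HM _ n1 k0) //.
by have -> : k%:~R + false%:R * (n + 1)%:~R / 2 = k%:~R :> F by rewrite !mul0r addr0.
Qed.

Lemma act_Lxi n v : -1 <= n ->
  L n (A 0 true v) = A 0 true (L n v) + ((n + 1)%:~R / 2) *: A n true v.
Proof.
move=> n1; rewrite (act_LA HM _ n1 (lexx _)); last first.
  rewrite addr0 add0r mul1r mulf_eq0 invr_eq0 intr_eq0 pnatr_eq0 orbF /paplus.
  by move: n1; rewrite /pgplus; lia.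
by rewrite addr0 add0r mul1r.
Qed.

Lemma act_tt x : A 1 false (A 1 false x) = A 2 false x.
Proof. by rewrite (act_AA HM). Qed.

Lemma act_ttt x : A 1 false (A 1 false (A 1 false x)) = A 3 false x.
Proof. by rewrite act_tt (act_AA HM). Qed.

Let t := @Alin 1 false isT.
Let xi := @Alin 0 true isT.
Let Lm := @Llin (-1) isT.
Let L0 := @Llin 0 isT.
Let L1 := @Llin 1 isT.
Let L2 := @Llin 2 isT.
Let Gm := @Glin (-1) isT.
Let pm : pgplus (-1). Proof. by []. Qed.

(** Transparent, so that its operators are convertible to the actions of the
    corresponding elements. *)
Definition contact_of : contact_ops M.
Proof.
refine (@ContactOps _ _ t xi Lm L0 L1 L2 Gm
  _ _ _ _ _ _ _ _ _ _ _ _ _ _ _ _ _ _).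
- by move=> x; rewrite /xi /= (act_AA HM).
- by move=> x; rewrite /xi /t /= !(act_AA HM).
- by move=> x; rewrite /Lm /t /= act_LA0 // (act_t0 HM) scale1r.
- by move=> x; rewrite /L0 /t /= act_LA0 // scale1r.
- by move=> x; rewrite /L1 /t /= act_tt act_LA0 // scale1r.
- by move=> x; rewrite /L2 /t /= act_ttt act_LA0 // scale1r.
- by move=> x; rewrite /Lm /xi /= act_Lxi // mul0r scale0r addr0.
- by move=> x; rewrite /L0 /xi /= act_Lxi // mul1r.
- by move=> x; rewrite /Gm /t /xi /= (act_GA0 HM) // scale1r.
- by move=> x; rewrite /Gm /xi /= (act_GA1 HM) // (act_t0 HM).
- move=> x; apply: (scalerI (a := 2)); first by rewrite pnatr_eq0.
  have GG := act_GG HM x pm pm (isT : pgplus (-1 + -1 + 1)).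
  rewrite (_ : -1 + -1 + 1 = -1 :> int) // in GG.
  rewrite /Gm /Lm /= scalerN -[LHS]/((1 + 1) *: _) scalerDl !scale1r {1}GG.
  by rewrite addrAC addNr sub0r.
- move=> x; rewrite /Gm /Lm /= (act_LG HM x pm pm).
    by rewrite (_ : _ - _ = 0); [rewrite scale0r addr0 | field].
  by rewrite (_ : _ - _ = 0) ?eqxx //; field.
- move=> x; rewrite /Gm /L0 /= (act_LG HM x (isT : pgplus 0) pm) // add0r.
  by congr (_ + _); rewrite -scaleNr; congr (_ *: _); field.
- by move=> x; rewrite /L0 /Lm /= (act_LL HM x (isT : pgplus 0) pm) // add0r scaleN1r.
- move=> x; rewrite /L1 /Lm /L0 /= (act_LL HM x (isT : pgplus 1) pm) //.
  by rewrite addrN -scaleNr.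
- move=> x; rewrite /L2 /Lm /L1 /= (act_LL HM x (isT : pgplus 2) pm) //.
  by rewrite (_ : 2 - 1 = 1 :> int) // -scaleNr.
- move=> x; rewrite /L1 /L0 /= (act_LL HM x (isT : pgplus 1) (isT : pgplus 0)) //.
  by rewrite addr0 scaleN1r.
- move=> x; rewrite /L2 /L0 /= (act_LL HM x (isT : pgplus 2) (isT : pgplus 0)) //.
  by rewrite addr0 -scaleNr.
Defined.

Lemma op_GE x : op_G contact_of x = G (-1) x. Proof. by []. Qed.

End PlusModule.

(** * Submodules generated by a lowest weight vector *)
Section LowestWeight.
Variables (F : numFieldType) (M : superrep F).
Hypothesis HM : is_Ag_module (gsub F pgplus) (Asub F paplus) M.
Local Notation S := (semidirect (gsub F pgplus) (Asub F paplus)).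
Local Notation L n := (@act F M (@kL F n, 0)).
Local Notation G n := (@act F M (@kG F n, 0)).
Local Notation A k e := (@act F M (0, @ta F k e)).
Variables (q0 : bool) (gam : F) (y : M).
Hypothesis y_par : y \in par q0.
Hypothesis y_weight : L 0 y = gam *: y.
Hypothesis y_lowest : G (-1) y = 0.

(** Vectors obtained from [y] by the operators [L_n], [G_(n + 1/2)], [t^k xi^e] of
    nonnegative index, with their parity and with their level, which is twice the
    distance of their weight from that of [y]. Levels are integers so that lowering
    one never truncates; at a negative level only [0] occurs ([word_neg]). *)
Inductive word : bool -> int -> M -> Prop :=
| word_gen : word q0 0 y
| word_zero q j : word q j 0
| word_lin c q j v w : word q j v -> word q j w -> word q j (c *: v + w)
| word_L (n : nat) q j v : word q j v -> word q (j + 2 * n%:Z) (L n v)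
| word_G (n : nat) q j v : word q j v -> word (~~ q) (j + 2 * n%:Z + 1) (G n v)
| word_A (k : nat) e q j v : word q j v ->
    word (e (+) q) (j + 2 * k%:Z + e%:Z) (A k e v).

Let mod_M : is_module S M. Proof. by case: HM. Qed.
Let pn (n : nat) : pgplus n. Proof. by []. Qed.
Let pm : pgplus (-1). Proof. by []. Qed.
Let pk (k : nat) : paplus k. Proof. by []. Qed.

Lemma word_cast q j q' j' v : word q j v -> q = q' -> j = j' -> word q' j' v.
Proof. by move=> ? <- <-. Qed.

Lemma wordZ c q j v : word q j v -> word q j (c *: v).
Proof. by move=> wv; rewrite -[_ *: _]addr0; apply/word_lin/word_zero. Qed.
Lemma wordD q j v w : word q j v -> word q j w -> word q j (v + w).
Proof. by move=> wv ww; rewrite -[v]scale1r; apply: word_lin. Qed.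
Lemma wordN q j v : word q j v -> word q j (- v).
Proof. by rewrite -scaleN1r; apply: wordZ. Qed.

Lemma word_par q j v : word q j v -> v \in par q.
Proof.
elim=> [//|{}q {}j|c {}q {}j {}v w _ pv _ pw|n {}q {}j {}v _|n {}q {}j {}v _|k e {}q {}j {}v _].
- by have [] := par_submod mod_M q.
- by have [_] := par_submod mod_M q; apply.
- exact: (par_act_L HM (pn n)).
- exact: (par_act_G HM (pn n)).
- exact: (par_act_A HM e (pk k)).
Qed.

Lemma word_weight q j v : word q j v -> L 0 v = (gam + j%:~R / 2) *: v.
Proof.
have L0_vZ c w : L 0 (c *: w) = c *: L 0 w by apply: (act_vZ HM _ _ (S_L F paplus (pn 0))).
have L_Z X c w : X \in S -> act X (c *: w) = c *: act X w :> M by apply: (act_vZ HM).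
elim=> [|{}q {}j|c {}q {}j {}v w _ wv _ ww
  |n {}q {}j {}v _ wv|n {}q {}j {}v _ wv|k e {}q {}j {}v _ wv].
- by rewrite mul0r addr0.
- by rewrite scaler0; apply: (linear0 (act_lin HM (S_L F paplus (pn 0)))).
- by rewrite (act_linearr mod_M) ?(S_L F paplus) // wv ww; lmod.
- rewrite (act_LL HM v (pn 0) (pn n) (fun _ => pn n)) wv (L_Z _ _ _ (S_L F paplus (pn n))).
  by rewrite add0r subr0 rmorphD rmorphM /=; lmod.
- rewrite (act_LG HM v (pn 0) (pn n) (fun _ => pn n)) wv (L_Z _ _ _ (S_G F paplus (pn n))).
  by rewrite add0r !rmorphD rmorphM /=; lmod.
- rewrite (act_LA HM v (pn 0) (pk k)) // wv (L_Z _ _ _ (S_ta F pgplus e (pk k))).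
  rewrite (add0r k%:Z) (add0r 1) -scalerDl; congr (_ *: _); rewrite !rmorphD rmorphM /=.
  by case: e; field.
Qed.

Lemma word_neg q j v : word q j v -> j < 0 -> v = 0.
Proof.
have act00 X : X \in S -> act X 0 = 0 :> M by move=> SX; apply: (linear0 (act_lin HM SX)).
elim=> [|//|c {}q {}j {}v w _ IHv _ IHw
  |n {}q {}j {}v _ IH|n {}q {}j {}v _ IH|k e {}q {}j {}v _ IH] //.
- by move=> j0; rewrite IHv ?IHw // scaler0 addr0.
- by move=> j0; rewrite IH ?act00 ?(S_L F paplus) //; lia.
- by move=> j0; rewrite IH ?act00 ?(S_G F paplus) //; lia.
- by move=> j0; rewrite IH ?act00 ?(S_ta F pgplus) //; case: e j0; lia.
Qed.

(** Moving [G_(-1/2)] to the right through a word until it meets [y] leaves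
    words of level one less. *)
Lemma word_Gm q j v : word q j v -> word (~~ q) (j - 1) (G (-1) v).
Proof.
elim=> [|{}q {}j|c {}q {}j {}v w _ wv _ ww
  |n {}q {}j {}v wv IH|n {}q {}j {}v wv IH|k e {}q {}j {}v wv IH].
- by rewrite y_lowest; apply: word_zero.
- by rewrite [G _ _](linear0 (act_lin HM (S_G F paplus pm))); apply: word_zero.
- by rewrite (act_linearr mod_M) ?(S_G F paplus) //; apply: word_lin.
- have pnm : pgplus (n%:Z + -1) by rewrite /pgplus; lia.
  have /eq_addr_sub -> := act_LG HM v (pn n) pm (fun _ => pnm).
  apply: wordD; first by apply: word_cast (word_L n IH) _ _; lia.
  apply/wordN/wordZ; case: n {pnm} => [|n]; first by apply: word_cast IH _ _; lia.
  rewrite (_ : n.+1%:Z + -1 = n); last lia.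
  by apply: word_cast (word_G n wv) _ _; lia.
- have pnG : pgplus (-1 + n%:Z + 1) by rewrite /pgplus; lia.
  rewrite (act_GG HM v pm (pn n) pnG) (_ : -1 + n%:Z + 1 = n); last lia.
  apply: wordD; first by apply/wordN; apply: word_cast (word_G n IH) _ _; lia.
  by apply/wordN/wordZ; apply: word_cast (word_L n wv) _ _; rewrite ?negbK //; lia.
- case: e.
    have pkG : paplus (-1 + k%:Z + 1) by rewrite /paplus; lia.
    rewrite (act_GA1 HM v pm (pk k) pkG) (_ : -1 + k%:Z + 1 = k); last lia.
    apply: wordD; first by apply/wordN; apply: word_cast (word_A k true IH) _ _; lia.
    by apply/wordN; apply: word_cast (word_A k false wv) _ _; rewrite ?negbK //=; lia.
  have pkG : k%:Z != 0 -> paplus (-1 + k%:Z) by rewrite /paplus; lia.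
  rewrite (act_GA0 HM v pm (pk k) pkG); apply: wordD.
    by apply: word_cast (word_A k false IH) _ _; lia.
  case: k {pkG} => [|k]; first by rewrite scale0r; apply: word_zero.
  rewrite (_ : -1 + k.+1%:Z = k); last lia.
  by apply/wordZ; apply: word_cast (word_A k true wv) _ _; rewrite /=; lia.
Qed.

Lemma word_Lm q j v : word q j v -> word q (j - 2) (L (-1) v).
Proof.
move=> wv; have -> : L (-1) v = - G (-1) (G (-1) v).
  by rewrite -!op_GE op_G_G opprK.
apply/wordN; have := word_Gm (word_Gm wv); rewrite negbK => /word_cast; apply=> //.
lia.
Qed.

Definition word_span : {pred M} := fun v => `[< exists2 s : seq M,
  forall w, w \in s -> exists q j, word q j w & v = \sum_(w <- s) w >].

Lemma word_spanP v : reflect (exists2 s : seq M,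
  forall w, w \in s -> exists q j, word q j w & v = \sum_(w <- s) w) (v \in word_span).
Proof. exact: asboolP. Qed.

Lemma word_in_span q j v : word q j v -> v \in word_span.
Proof.
move=> wv; apply/word_spanP; exists [:: v]; last by rewrite big_seq1.
by move=> w; rewrite inE => /eqP->; exists q, j.
Qed.

Lemma word_span_submod : submod_closed word_span.
Proof.
split; first by apply: word_in_span (word_zero q0 0).
move=> c _ _ /word_spanP[s1 W1 ->] /word_spanP[s2 W2 ->]; apply/word_spanP.
exists (map ( *:%R c) s1 ++ s2); last by rewrite big_cat big_map scaler_sumr.
move=> w; rewrite mem_cat => /orP[/mapP[w1 /W1[q [j wv]] ->]|/W2//].
by exists q, j; apply: wordZ.
Qed.

(** Only [L_(-1)] and [G_(-1/2)] are not among the operators used to build words;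
    [word_Gm] and [word_Lm] take care of them. *)
Lemma word_span_submodule : is_submodule S word_span.
Proof.
have [span0 span_lin] := word_span_submod.
have spanD v w : v \in word_span -> w \in word_span -> v + w \in word_span.
  by move=> vN wN; rewrite -[v]scale1r; apply: span_lin.
split; first exact: word_span_submod.
  move=> _ /word_spanP[s W ->].
  have par0 p : (0 : M) \in par p by have [] := par_submod mod_M p.
  have parD p v w : v \in par p -> w \in par p -> v + w \in @par F M p.
    by move=> vp wp; rewrite -[v]scale1r; have [_] := par_submod mod_M p; apply.
  elim: s W => [|w s IH] W.
    by exists 0, 0; rewrite big_nil addr0; split; rewrite ?span0 ?par0.
  have [v0 [v1 [N0 N1 p0 p1 sE]]] := IH (fun z zs => W z (mem_behead (s := w :: s) zs)).
  have [[] [j ww]] := W w (mem_head _ _).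
    exists v0, (w + v1); rewrite big_cons sE addrCA; split=> //.
      exact: spanD (word_in_span ww) N1.
    exact: parD (word_par ww) p1.
  exists (w + v0), v1; rewrite big_cons sE addrA; split=> //.
    exact: spanD (word_in_span ww) N0.
  exact: parD (word_par ww) p0.
move=> X _ SX /word_spanP[s W ->].
rewrite -[act X _]/(act_lin HM SX _) linear_sum /=.
have -> : \sum_(w <- s) act X w = \sum_(w <- s) 1 *: act X w.
  by apply: eq_bigr => w _; rewrite scale1r.
apply: submod_closed_sum word_span_submod _ => w /W[q [j ww]].
case: X SX => u a SX; have /andP[/= /allP Su /allP Sa] := SX.
rewrite (act_lext HM) //; apply: spanD; apply: submod_closed_sum word_span_submod _.
  move=> [[] [n|n]] /Su; rewrite /on_k /pgplus //= => n0.
  - exact: word_in_span (word_G n ww).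
  - by rewrite (_ : Negz n = -1); [apply: word_in_span (word_Gm ww) | lia].
  - exact: word_in_span (word_L n ww).
  - by rewrite (_ : Negz n = -1); [apply: word_in_span (word_Lm ww) | lia].
move=> [[k|k] e] /Sa; rewrite /on_A /paplus //= => _.
exact: word_in_span (word_A k e ww).
Qed.

(** [y] generates a submodule with no weight below that of [y]. *)
Lemma lowest_weight mu x : simple S M -> y != 0 -> x != 0 -> L 0 x = mu *: x ->
  exists j : nat, mu = gam + j%:R / 2.
Proof.
move=> [_ simpleM] nz_y nz_x wt_x.
have [N0|Nall] := simpleM _ word_span_submodule.
  by case/eqP: nz_y; apply: N0; apply: word_in_span word_gen.
have [//|no_j] := pselect (exists j : nat, mu = gam + j%:R / 2).
case/eqP: nz_x; have /word_spanP[s W xE] := Nall x.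
rewrite xE; apply: (@sum_eigenvectors_eq0 F M (act_lin HM (S_L F paplus (pn 0))) mu); last first.
  by rewrite -xE.
move=> w /W[q [[j|j] ww]].
  exists (gam + j%:R / 2); last exact: word_weight ww.
  by apply/eqP => E; apply: no_j; exists j.
exists (mu + 1); last first.
  by rewrite (word_neg ww) // scaler0; apply: (linear0 (act_lin HM (S_L F paplus (pn 0)))).
by rewrite -subr_eq0 addrC addKr oner_eq0.
Qed.

End LowestWeight.

(** * Isomorphisms with the modules of densities *)
Section Superspace.
Variables (F : numFieldType) (S : {pred ktilde F}) (M : superrep F).
Hypothesis mod_M : is_module S M.

(** A vector that satisfies homogeneous linear equations has a nonzero homogeneous
    component, and this satisfies the same equations. *)
Lemma nonzero_component (v : M) : v != 0 -> exists q v', [/\ v' != 0, v' \in par q &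
  forall p (T : M -> M), {morph T : x y / x + y} ->
    (forall q' w, w \in par q' -> T w \in @par F M (p (+) q')) -> T v = 0 -> T v' = 0].
Proof.
have [v0 [v1 [par0 par1 ->]]] := par_decomp mod_M v.
have components p (T : M -> M) : {morph T : x y / x + y} ->
    (forall q' w, w \in par q' -> T w \in @par F M (p (+) q')) ->
    T (v0 + v1) = 0 -> T v0 = 0 /\ T v1 = 0.
  move=> TD Tp; rewrite TD => T01.
  have Tv0 : T v0 = - 1 *: T v1 + 0 by rewrite scaleN1r addr0; apply/eqP; rewrite -addr_eq0 T01.
  have Tv0_par : T v0 \in par (p (+) true).
    by rewrite Tv0; have [par00] := par_submod mod_M (p (+) true); apply; rewrite ?Tp.
  have : T v0 = 0 by have := Tp _ _ par0; case: (p) Tv0_par => /= h1 h2; apply: (par_direct mod_M).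
  by move=> T0; move: T01; rewrite T0 add0r.
have [v00|nz0] := eqVneq v0 0.
  move=> nz; exists true, v1; split=> // [|p T TD Tp T0].
    by move: nz; rewrite v00 add0r.
  by have [] := components p T TD Tp T0.
move=> _; exists false, v0; split=> // p T TD Tp T0.
by have [] := components p T TD Tp T0.
Qed.

(** The isomorphism is the inverse of [g]. It respects parities because the
    component of the wrong parity of a preimage is mapped into both parities at
    once, hence to zero. *)
Lemma isomorphic_of_map (N : superrep F) (g : {linear N -> M}) (q : bool) :
    (forall w, g w = 0 -> w = 0) -> (forall v, exists w, v = g w) ->
    (forall w : N, exists w0 w1 : N, [/\ w0 \in par false, w1 \in par true & w = w0 + w1]) ->
    (forall p w, w \in par p -> g w \in @par F M (p (+) q)) ->
    (forall X w, X \in S -> g (act X w) = act X (g w)) ->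
  isomorphic S M N.
Proof.
move=> g_inj g_surj decomp_N g_par g_act.
have [f gf] := choice g_surj.
have fg : cancel g f.
  by move=> w; apply/eqP; rewrite -subr_eq0; apply/eqP/g_inj; rewrite linearB /= -gf subrr.
have gf' : cancel f g by move=> v; rewrite -gf.
pose f_lin : {linear M -> N} := HB.pack f
  (GRing.isLinear.Build F M N *:%R f (can2_linear fg gf')).
exists q, f_lin; split.
- by exists g.
- move=> q' v pv /=; have [w0 [w1 [p0 p1 fvE]]] := decomp_N (f v).
  have gfv : v = g w0 + g w1 by rewrite -linearD -fvE gf'.
  have diff p (a b : M) : a \in par p -> b \in par p -> a - b \in @par F M p.
    move=> pa pb; have [par00 plin] := par_submod mod_M p.
    by rewrite addrC -scaleN1r; apply: plin.
  rewrite fvE; case E : (q (+) q').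
    suff -> : w0 = 0 by rewrite add0r.
    apply: g_inj; have g0 : g w0 \in par (~~ q').
      by have := g_par _ _ p0; case: (q) (q') E => [] [].
    have : g w0 \in par q'.
      have -> : g w0 = v - g w1 by rewrite gfv addrK.
      by apply: diff => //; have := g_par _ _ p1; case: (q) (q') E => [] [].
    by case: (q') g0 => /= h1 h2; apply: (par_direct mod_M).
  suff -> : w1 = 0 by rewrite addr0.
  apply: g_inj; have g1 : g w1 \in par (~~ q').
    by have := g_par _ _ p1; case: (q) (q') E => [] [].
  have : g w1 \in par q'.
    have -> : g w1 = v - g w0 by rewrite gfv addrC addKr.
    by apply: diff => //; have := g_par _ _ p0; case: (q) (q') E => [] [].
  by case: (q') g1 => /= h1 h2; apply: (par_direct mod_M).
- by move=> X v SX /=; apply: (can_inj fg); rewrite g_act // !gf'.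
Qed.

End Superspace.

Section FamilyIsomorphism.
Variables (F : numFieldType) (pg pa P : pred int) (M : superrep F).
Hypothesis HM : is_Ag_module (gsub F pg) (Asub F pa) M.
Local Notation S := (semidirect (gsub F pg) (Asub F pa)).
Variables (lam b : F) (x : int -> M) (q : bool).
Hypothesis fam : density_family pg pa P lam b x.
Hypothesis x_par : forall k, P k -> x k \in par q.
Hypothesis simpleM : simple S M.
Local Notation phi := (family_map x).

Let mod_M : is_module S M. Proof. by case: HM. Qed.

Lemma isomorphic_Gamma : (forall k, P k) -> (forall k, x k != 0) ->
  isomorphic S M (Gamma lam b).
Proof.
move=> P_all nz_x; have all_P (y : laurent F) : y \in supported (on_A P).
  by apply/allP => i _; apply: P_all.
apply: (@isomorphic_of_map _ _ _ mod_M (Gamma lam b) phi q).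
- move=> y phi0; apply/malgP => -[k e]; rewrite mcoeff0.
  exact: (family_map_coef_eq0 HM fam (all_P y) phi0
    (family_map_basis_neq0 HM fam e (P_all k) (nz_x k))).
- move=> v; have [y _ vE] := family_map_surj HM fam x_par simpleM (P_all 0) (nz_x 0) v.
  by exists y.
- move=> y; exists (homog_part snd false y), (homog_part snd true y).
  by split; [exact: homog_part_homog | exact: homog_part_homog | exact: homog_part_sum].
- by move=> p y; apply: (family_map_par HM fam x_par (all_P y)).
- by move=> X y SX; apply: (family_map_act HM fam SX (all_P y)).
Qed.

End FamilyIsomorphism.

Section PlusIsomorphisms.
Variables (F : numFieldType) (M : superrep F).
Hypothesis HM : is_Ag_module (gsub F pgplus) (Asub F paplus) M.
Local Notation S := (semidirect (gsub F pgplus) (Asub F paplus)).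
Variables (b : F) (x : int -> M) (q : bool).
Hypothesis simpleM : simple S M.
Local Notation phi := (family_map x).

Let mod_M : is_module S M. Proof. by case: HM. Qed.

Lemma isomorphic_Gamma_plus :
    density_family pgplus paplus paplus 0 b x ->
    (forall k, paplus k -> x k \in par q) -> (forall k, paplus k -> x k != 0) ->
  isomorphic S M (Gamma_plus b).
Proof.
move=> fam x_par nz_x.
pose N := Gamma_plus b.
pose inN (y : laurent F) (Py : y \in @Aplus F) : N := Subspace Py.
have NP (w : N) : val w \in supported (on_A paplus) by apply: valP.
pose g (w : N) : M := phi (val w).
have g_linear : linear g.
  have val_linear c (v w : subspace (@Aplus F)) : val (c *: v + w) = c *: val v + val w.
    exact: linearP.
  by move=> c v w; rewrite /g [val _]val_linear; apply: (linearP phi).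
pose g_lin : {linear N -> M} := HB.pack g (GRing.isLinear.Build F N M *:%R g g_linear).
apply: (@isomorphic_of_map _ _ _ mod_M N g_lin q).
- move=> w phi0; suff w0 : val w = 0.
    apply: val_inj; rewrite w0.
    exact/esym/(linear0 (val : {linear subspace (@Aplus F) -> laurent F})).
  apply/malgP => -[k e]; rewrite mcoeff0.
  have [k0|nk0] := boolP (paplus k).
    exact: (family_map_coef_eq0 HM fam (NP w) phi0 
      (family_map_basis_neq0 HM fam e k0 (nz_x k k0))).
  by have /supportedP := NP w; apply.
- move=> v; have [y Py vE] := family_map_surj HM fam x_par simpleM
    (lexx 0 : paplus 0) (nz_x 0 (lexx 0)) v.
  by exists (inN y Py).
- move=> w; have P_part p := homog_part_supported snd p (NP w).
  exists (inN _ (P_part false)), (inN _ (P_part true)).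
  split; [exact: homog_part_homog | exact: homog_part_homog |].
  apply: val_inj; rewrite {1}(homog_part_sum snd (val w)).
  exact/esym/(linearD (val : {linear subspace (@Aplus F) -> laurent F})).
- by move=> p w; apply: (family_map_par HM fam x_par (NP w)).
- move=> X w SX; rewrite /= /g.
  have -> : val (act X w : N) = Gamma_act 0 b X (val w).
    by rewrite /= insubdK //; apply: (Gamma_act_supported fam SX (NP w)).
  by apply: (family_map_act HM fam SX (NP w)).
Qed.

(** The map [t^k xi^e |-> xi^e (x k)] is defined on all of [Gamma (0, b)], and its kernel
    is [A^+]. *)
Lemma isomorphic_Gamma_minus :
    density_family pgplus paplus predT 0 b x ->
    (forall k, x k \in par q) -> (forall k, 0 <= k -> x k = 0) ->
    (forall k, k < 0 -> x k != 0) ->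
  isomorphic S M (Gamma_minus b).
Proof.
move=> fam x_par x0 nz_x.
have all_P (y : laurent F) : y \in supported (on_A predT) by apply/allP.
have A0_linear : linear (@act F M (0, ta F 0 true)).
  exact: (linearP (act_lin HM (S_ta F pgplus true (lexx 0 : paplus 0)))).
pose A0 : {linear M -> M} := HB.pack (@act F M (0, ta F 0 true))
  (GRing.isLinear.Build F M M *:%R _ A0_linear).
have phi_plus y : y \in Aplus -> phi y = 0.
  move=> /allP Py; rewrite /family_map /lext big_seq big1 // => -[k e] /Py /= k0.
  by rewrite x0 //; case: e; rewrite ?[act _ 0](linear0 A0) scaler0.
have phi_repr (y : laurent F) : phi (repr (\pi_(quotient Aplus) y)) = phi y.
  apply/eqP; rewrite -subr_eq0 -linearB; apply/eqP/phi_plus.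
  have : (repr (\pi_(quotient Aplus) y) - y \in zmod_part Aplus) = true.
    by rewrite Quotient.idealrBE reprK eqxx.
  by [].
pose N := Gamma_minus b.
pose g (w : N) : M := phi (repr (w : quotient Aplus)).
have g_pi (y : laurent F) : g (\pi_(quotient Aplus) y) = phi y by apply: phi_repr.
have pi_linear c (y z : laurent F) : c *: (\pi_(quotient Aplus) y : quotient Aplus)
    + \pi_(quotient Aplus) z = \pi_(quotient Aplus) (c *: y + z).
  by rewrite [c *: _]pi_scale -(raddfD (\pi_(quotient Aplus))).
have piE (w : N) : exists y : laurent F, w = \pi_(quotient Aplus) y.
  by exists (repr (w : quotient Aplus)); rewrite reprK.
have g_linear : linear g.
  move=> c v w; have [y ->] := piE v; have [z ->] := piE w.
  by rewrite [_ + _]pi_linear !g_pi; apply: (linearP phi).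
pose g_lin : {linear N -> M} := HB.pack g (GRing.isLinear.Build F N M *:%R g g_linear).
apply: (@isomorphic_of_map _ _ _ mod_M N g_lin q).
- move=> w; have [y ->] := piE w; rewrite [g_lin _]g_pi => phi0.
  apply/eqP; rewrite -[0 : N]/(0 : quotient Aplus) -(raddf0 (\pi_(quotient Aplus))).
  rewrite -Quotient.idealrBE subr0.
  have : y \in Aplus.
    apply/supportedP => -[k e] /= k0.
    have nz := family_map_basis_neq0 HM fam e (erefl : predT k) (nz_x k _).
    by apply: (family_map_coef_eq0 HM fam (all_P y) phi0 (nz _)); rewrite ltNge.
  by [].
- have nz1 : x (-1) != 0 by apply: nz_x.
  move=> v; have [y _ vE] := family_map_surj HM fam (fun k _ => x_par k) simpleM
    (erefl : predT (-1)) nz1 v.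
  by exists (\pi_(quotient Aplus) y); rewrite [g_lin _]g_pi.
- move=> w; have [y ->] := piE w.
  exists (\pi_(quotient Aplus) (homog_part snd false y)),
    (\pi_(quotient Aplus) (homog_part snd true y)); split.
  + by apply/asboolP; exists (homog_part snd false y) => //; apply: homog_part_homog.
  + by apply/asboolP; exists (homog_part snd true y) => //; apply: homog_part_homog.
  + rewrite {1}(homog_part_sum snd y); exact: (raddfD (\pi_(quotient Aplus))).
- move=> p w /asboolP[y hy ->]; rewrite [g_lin _]g_pi.
  exact: (family_map_par HM fam (fun k _ => x_par k) (all_P y) hy).
- move=> X w SX; rewrite [g_lin (act X w)]g_pi.
  exact: (family_map_act HM fam SX (all_P _)).
Qed.

End PlusIsomorphisms.

(** * Density vectors over the polynomial algebra *)
Section HomogeneousDensity.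
Variables (F : numClosedFieldType) (M : superrep F).
Hypothesis HM : is_Ag_module (gsub F pgplus) (Asub F paplus) M.
Local Notation S := (semidirect (gsub F pgplus) (Asub F paplus)).
Local Notation C := (contact_of HM).
Local Notation L n := (@act F M (@kL F n, 0)).

Let mod_M : is_module S M. Proof. by case: HM. Qed.

Let par_lin p c v w : v \in par p -> w \in par p -> c *: v + w \in @par F M p.
Proof. by have [_] := par_submod mod_M p; apply. Qed.
Let parZ p c v : v \in par p -> c *: v \in @par F M p.
Proof.
move=> pv; rewrite -[_ *: _]addr0; apply: par_lin => //.
by have [] := par_submod mod_M p.
Qed.
Let parB p v w : v \in par p -> w \in par p -> v - w \in @par F M p.
Proof. by move=> pv pw; rewrite addrC -scaleN1r; apply: par_lin. Qed.
Let par_t p v : v \in par p -> op_t C v \in @par F M p.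
Proof. by move=> pv; have := par_act_A HM (k := 1) false isT pv. Qed.
Let par_xi p v : v \in par p -> op_xi C v \in @par F M (~~ p).
Proof. by move=> pv; have := par_act_A HM (k := 0) true isT pv. Qed.
Let par_Ln n p v : pgplus n -> v \in par p -> L n v \in @par F M p.
Proof. exact: (par_act_L HM). Qed.
Let par_G p v : v \in par p -> op_G C v \in @par F M (~~ p).
Proof. exact: (par_act_G HM (isT : pgplus (-1))). Qed.

(** The equations defining a density vector are homogeneous, the first odd and
    the others even. *)
Lemma homogeneous_density lam b u : u != 0 -> density C lam b u ->
  exists q u', [/\ u' != 0, u' \in par q & density C lam b u'].
Proof.
move=> /(nonzero_component mod_M)[q [u' [nz_u' par_u' comp]]].
case=> G_u tLm_u L0_u L1_u L2_u; exists q, u'; split=> //.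
have eqn p (T1 T2 : {linear M -> M}) :
    (forall q' w, w \in par q' -> T1 w \in @par F M (p (+) q')) ->
    (forall q' w, w \in par q' -> T2 w \in @par F M (p (+) q')) -> T1 u = T2 u -> T1 u' = T2 u'.
  move=> par1 par2 T12; apply/eqP; rewrite -subr_eq0; apply/eqP.
  apply: (comp p (T1 \- T2)); last by rewrite /= T12 subrr.
    exact: linearD.
  by move=> q' w pw; apply: parB; [apply: par1 | apply: par2].
have par_Lm p v : v \in par p -> op_Lm C v \in @par F M p by apply: par_Ln.
split.
- apply: (eqn true (op_G C) (op_xi C \o op_Lm C)) G_u => p v pv; first exact: par_G.
  exact/par_xi/par_Lm.
- apply: (eqn false (op_t C \o op_Lm C) (lam \*: idfun)) tLm_u => p v pv; last exact: parZ.
  exact/par_t/par_Lm.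
- by apply: (eqn false (op_L0 C) ((lam + b) \*: idfun)) L0_u => p v pv;
    [apply: par_Ln | apply: parZ].
- apply: (eqn false (op_L1 C) ((lam + 2 * b) \*: op_t C)) L1_u => p v pv; first exact: par_Ln.
  exact/parZ/par_t.
- apply: (eqn false (op_L2 C) ((lam + 3 * b) \*: (op_t C \o op_t C))) L2_u => p v pv.
    exact: par_Ln.
  exact/parZ/par_t/par_t.
Qed.

Variable lam0 : F.
Hypothesis simpleM : simple S M.
Hypothesis lam0_spanned : fin_spanned (fun v : M => L 0 v = lam0 *: v).
Hypothesis lam0_weight : exists2 v : M, v != 0 & L 0 v = lam0 *: v.

(** An eigenvector of [h] is carried into the weight space of [lam0] by powers
    of [L_(-1)] or of [t], unless it is annihilated on the way. In the first case
    the vector annihilated by [L_(-1)], or its image under [G_(-1/2)], generates a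
    submodule of weights at least [b - 1/2]; in the second the eigenvalue [b] is at
    most [lam0]. *)
Lemma plus_h_bounded : exists rs : seq F, forall (m : int) x b,
  h_eigenvector_at C (lam0 + m%:~R) b x ->
  b \in rs \/ exists i : nat, b = lam0 + 2^-1 - i%:R / 2.
Proof.
apply: (@h_bounded_of_steps F M C lam0 lam0_spanned) => n b x [nz_x wt_x h_x].
  have [Lm_x|nz_Lm] := eqVneq (op_Lm C x) 0; last first.
    left; exists (op_Lm C x); split=> //.
      by rewrite op_L0_Lm wt_x linearZ /= -addn1 natrD; lmod.
    by rewrite h_Lm h_x linearZ.
  right; have [q [x' [nz_x' par_x' comp]]] := nonzero_component mod_M nz_x.
  have Lm_x' : op_Lm C x' = 0.
    apply: (comp false (op_Lm C)) => //; first exact: linearD.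
    by move=> p v; apply: par_Ln.
  have L0_x' : L 0 x' = b *: x'.
    apply/eqP; rewrite -subr_eq0; apply/eqP.
    apply: (comp false (op_L0 C \- b \*: idfun)).
    - exact: linearD.
    - by move=> p v pv; apply: parB; [apply: par_Ln | apply: parZ].
    - by rewrite /= -h_x /h_op Lm_x linear0 subr0 subrr.
  have [v nz_v wt_v] := lam0_weight.
  have [G_x'|nz_G] := eqVneq (op_G C x') 0.
    have [j lam0E] := lowest_weight HM par_x' L0_x' G_x' simpleM nz_x' nz_v wt_v.
    by exists j.+1; rewrite lam0E -addn1 natrD; field.
  have GG : @act F M (@kG F (-1), 0) (op_G C x') = 0.
    by have := op_G_G C x'; rewrite Lm_x' oppr0.
  have L0_G : L 0 (op_G C x') = (b - 2^-1) *: op_G C x'.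
    have -> : L 0 (op_G C x') = op_G C (L 0 x') - 2^-1 *: op_G C x' by apply: op_L0_G.
    by rewrite L0_x' linearZ /= scalerBl.
  have [j lam0E] := lowest_weight HM (par_G par_x') L0_G GG simpleM nz_G nz_v wt_v.
  by exists j; rewrite lam0E; field.
have [t_x|nz_t] := eqVneq (op_t C x) 0; last first.
  left; exists (op_t C x); split=> //.
    by rewrite op_L0_t wt_x linearZ /= -addn1 natrD; lmod.
  by rewrite h_t h_x linearZ.
(* Here [L_(-1) t x = 0], so that [b] is the weight of [t x], [lam0 - n]. *)
right; exists (2 * n + 1)%N.
have tLm_x : op_t C (op_Lm C x) = - x.
  have := op_Lm_t C x; rewrite t_x linear0 => /esym/eqP.
  by rewrite addr_eq0 => /eqP.
have : (lam0 - n.+1%:R + 1 - b) *: x = 0.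
  by rewrite scalerBl -h_x /h_op wt_x tLm_x; lmod.
move/eqP; rewrite scaler_eq0 (negPf nz_x) orbF subr_eq0 => /eqP <-.
by rewrite -[n.+1]addn1 natrD [(2 * n + 1)%:R]natrD natrM; field.
Qed.

End HomogeneousDensity.

(** * Classification *)
Lemma small_int_cases (n : int) : -1 <= n <= 2 -> [\/ n = -1, n = 0, n = 1 | n = 2].
Proof.
by case: n => [[|[|[|n]]]|[|n]] //= _; [constructor 2|constructor 3|constructor 4|constructor 1].
Qed.

Section StringFamily.
Variables (F : numClosedFieldType) (M : superrep F).
Hypothesis HM : is_Ag_module (gsub F pgplus) (Asub F paplus) M.
Local Notation C := (contact_of HM).

Lemma string_density_family (P : pred int) lam b (x : int -> M) :
    (forall k j, P k -> paplus j -> P (k + j)) ->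
    (forall k, P k -> P (k - 1) \/ lam + k%:~R = 0) ->
    (forall k, P k -> [/\ density C (lam + k%:~R) b (x k), op_t C (x k) = x (k + 1)
      & op_Lm C (x k) = (lam + k%:~R) *: x (k - 1)]) ->
  density_family pgplus paplus P lam b x.
Proof.
move=> P_pa P_down str; split=> //.
- by move=> n; rewrite /pgplus; lia.
- by move=> n; rewrite /pgplus /paplus; lia.
- by move=> n; rewrite /pgplus /paplus; lia.
- move=> k [j|//] Pk _; elim: j => [|j IH]; first by rewrite (act_t0 HM) addr0.
  have [_ t_x _] := str _ (P_pa k j Pk isT).
  have AA v : @act F M (0, ta F 1 false) (@act F M (0, ta F j false) v)
      = act (0, ta F (1 + j%:Z) false) v by rewrite (act_AA HM).
  by rewrite intS -AA IH [LHS]t_x (addrC 1) addrA.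
- move=> n k /small_int_cases n_cases Pk.
  have [[_ _ L0_x L1_x L2_x] t_x Lm_x] := str k Pk.
  have [_ t_x1 _] := str _ (P_pa k 1 Pk isT).
  case: n_cases => ->.
  + by rewrite [LHS]Lm_x addNr mulr0 addr0 (addrC k).
  + by rewrite add0r mulr1 add0r.
  + by rewrite [LHS]L1_x t_x (addrC 1 k); lmod.
  + by rewrite [LHS]L2_x t_x t_x1 (addrC 2 k) -(addrA k); lmod.
- move=> k Pk; have [[G_x _ _ _ _] _ Lm_x] := str k Pk.
  by rewrite [LHS]G_x Lm_x linearZ.
- by left.
Qed.

End StringFamily.

Section LaurentFamily.
Variables (F : numClosedFieldType) (M : superrep F) (pg : pred int).
Hypothesis HM : is_Ag_module (gsub F pg) (Asub F predT) M.
Hypothesis HMp : is_Ag_module (gsub F pgplus) (Asub F paplus) M.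
Local Notation C := (contact_of HMp).
Local Notation L n := (@act F M (@kL F n, 0)).
Local Notation G n := (@act F M (@kG F n, 0)).
Local Notation A k e := (@act F M (0, @ta F k e)).
Variables (lam b : F) (u : M).
Hypothesis pgN1 : forall n, -1 <= n -> pg n.
Hypothesis density_u : density C lam b u.
Hypothesis low : (forall n, pg n -> -1 <= n) \/
  (forall n, pg n) /\ L (-2) u = (lam - b) *: A (-2) false u.

Let Z X (c : F) v : X \in semidirect (gsub F pg) (Asub F predT) ->
  act X (c *: v) = c *: act X v :> M.
Proof. exact: (act_vZ HM). Qed.
Let AA k j v : A k false (A j false v) = A (k + j) false v.
Proof. by rewrite (act_AA HM). Qed.

(** If [L_n u] has the form of a density of exponent [lam], then so has [L_n] on every
    [t^k u], with exponent [lam + k]. *)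
Lemma laurent_L n k : pg n -> L n u = (lam + b * (n + 1)%:~R) *: A n false u ->
  L n (A k false u) = (lam + k%:~R + b * (n + 1)%:~R) *: A (n + k) false u.
Proof.
move=> pn L_u; rewrite (act_LA HM u pn (erefl : predT k) (fun _ => erefl)) L_u.
rewrite (Z _ _ (S_ta F pg false (erefl : predT k))) AA (addrC k n) -scalerDl.
by congr (_ *: _); rewrite !mul0r addr0 addrAC.
Qed.

Lemma laurent_density_family :
  density_family pg predT predT lam b (fun k => A k false u).
Proof.
have [G_u tLm_u L0_u L1_u L2_u] := density_u.
have LmE : L (-1) u = lam *: A (-1) false u.
  have -> : L (-1) u = A (-1) false (op_t C (op_Lm C u)).
    by rewrite [RHS]AA addNr (act_t0 HM).
  by rewrite tLm_u; apply: Z (S_ta F pg false (erefl : predT (-1))).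
have L_u n : -1 <= n <= 2 -> L n u = (lam + b * (n + 1)%:~R) *: A n false u.
  case/small_int_cases => ->.
  - by rewrite LmE addNr mulr0 addr0.
  - by rewrite (act_t0 HM) [LHS]L0_u add0r mulr1.
  - by rewrite [LHS]L1_u; congr (_ *: _); ring.
  - by rewrite [LHS]L2_u [op_t C _]AA; congr (_ *: _); ring.
split=> //.
- by move=> n pn n2; case: low => [/(_ _ pn) ?|[-> //]]; apply: pgN1; lia.
- by left.
- by move=> k j _ _; rewrite AA addrC.
- move=> n k n12 _; apply: laurent_L; last exact: L_u.
  by apply: pgN1; case/andP: n12.
- move=> k _; have pm : pg (-1) by apply: pgN1.
  have GE : G (-1) u = lam *: A (-1) true u.
    rewrite [LHS]G_u [op_Lm C u]LmE linearZ; congr (_ *: _).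
    exact: (act_xi_t HM u (erefl : predT 0) (erefl : predT (-1))).
  rewrite (act_GA0 HM u pm (erefl : predT k) (fun _ => erefl)) GE.
  rewrite (Z _ _ (S_ta F pg false (erefl : predT k))) (act_AA HM) //.
  by rewrite (act_xi_t HM) // (addrC k (-1)) -scalerDl.
- case: low => [|[pg_all Lmm_u]]; [by left|right; split=> // k].
  apply: laurent_L => //; rewrite Lmm_u; congr (_ *: _).
  by rewrite (_ : -2 + 1 = -1 :> int) // rmorphN1 mulrN1.
Qed.

End LaurentFamily.

Section Classification.
Variable F : numClosedFieldType.
Implicit Type M : superrep F.

Lemma supported_sub (K : choiceType) (P Q : pred K) :
  (forall i, P i -> Q i) -> {subset @supported F K P <= supported Q}.
Proof. by move=> PQ y /allP Py; apply/allP => i /Py /PQ. Qed.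

Lemma kfullE : @kfull F = gsub F predT.
Proof. by apply/funext => u; rewrite /supported all_predT. Qed.

Lemma AfullE : @Afull F = Asub F predT.
Proof. by apply/funext => a; rewrite /supported all_predT. Qed.

(** Both for [k] and for [k^+] over the Laurent polynomials: the density vector is
    found with the help of [k^+] and [A^+] only, and [L_(-2)] is added when it acts. *)
Lemma invertible_classification (pg : pred int) M :
    (forall n, -1 <= n -> pg n) ->
    (forall n, pg n -> -1 <= n) \/ (forall n, pg n) ->
    is_jet (gsub F pg) (Asub F predT) M ->
    simple (semidirect (gsub F pg) (Asub F predT)) M ->
  exists lam b, isomorphic (semidirect (gsub F pg) (Asub F predT)) M (Gamma lam b).
Proof.
move=> pgN1 pg_low [HM _ [lam0 [v nz_v wt_v] fin]] simpleM.
have HMp : is_Ag_module (gsub F pgplus) (Asub F paplus) M.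
  by apply: is_Ag_module_sub HM; apply: supported_sub => -[? ?]; first exact: pgN1.
pose C := contact_of HMp.
have SA k e : (0, ta F k e) \in semidirect (gsub F pg) (Asub F predT) by apply: S_ta.
pose ti := act_lin HM (SA (-1) false).
have t_ti w : op_t C (ti w) = w.
  by have := act_AA HM false false w (erefl : predT 1) (erefl : predT (-1));
    rewrite addrN (act_t0 HM).
have ti_t w : ti (op_t C w) = w.
  by have := act_AA HM false false w (erefl : predT (-1)) (erefl : predT 1);
    rewrite addNr (act_t0 HM).
have lam0_spanned : fin_spanned (fun w : M => op_L0 C w = lam0 *: w) by apply: fin.
have [rs h_bounded] := h_bounded_invertible t_ti ti_t lam0_spanned.
have lam0_weight : exists2 w : M, w != 0 & op_L0 C w = lam0 *: w by exists v.
have [lam [b [j [u0 [nz_u0 den_u0 wtE top]]]]] :=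
  density_vector_exists lam0_spanned lam0_weight h_bounded.
have [q [u [nz_u par_u den_u]]] := homogeneous_density nz_u0 den_u0.
exists lam, b.
have low : (forall n, pg n -> -1 <= n) \/ (forall n, pg n) /\
    @act F M (@kL F (-2), 0) u = (lam - b) *: act (0, ta F (-2) false) u.
  case: pg_low => [|pg_all]; [by left | right; split=> //].
  have SLmm : (kL F (-2), 0) \in semidirect (gsub F pg) (Asub F predT) by apply: S_L.
  pose Lmm := act_lin HM SLmm.
  have Lmm_t w : Lmm (op_t C w) = op_t C (Lmm w) + ti w.
    rewrite [LHS](act_LA HM w (pg_all (-2)) (erefl : predT 1) (fun _ => erefl)).
    by rewrite !mul0r addr0 scale1r.
  have L0_Lmm w : op_L0 C (Lmm w) = Lmm (op_L0 C w) - 2 *: Lmm w.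
    rewrite [LHS](act_LL HM w (pg_all 0) (pg_all (-2)) (fun _ => pg_all _)).
    by rewrite subr0 add0r -scaleNr.
  have L1_Lmm w : op_L1 C (Lmm w) = Lmm (op_L1 C w) - 3 *: op_Lm C w.
    rewrite [LHS](act_LL HM w (pg_all 1) (pg_all (-2)) (fun _ => pg_all _)).
    by rewrite -scaleNr.
  have fin_u : fin_spanned (fun w : M => op_L0 C w = (lam + b) *: w).
    by rewrite wtE; apply: (fin_spanned_weight_steps t_ti ti_t).
  have no_above (i : nat) w : op_L0 C w = (lam + b) *: w ->
      h_op C w = (b + 1 + i%:R / 2) *: w -> w = 0.
    by rewrite wtE; apply: top.
  have -> : act (kL F (-2), 0) u = Lmm u by [].
  rewrite (Lmm_density t_ti ti_t Lmm_t L0_Lmm L1_Lmm den_u fin_u no_above).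
  by congr (_ *: _); rewrite [LHS](act_AA HM).
have fam := laurent_density_family HM pgN1 den_u low.
have nz_tu k : act (0, ta F k false) u != 0 :> M.
  apply: contraNneq nz_u => tu0.
  have uE : act (0, ta F (- k) false) (act (0, ta F k false) u) = u :> M.
    by rewrite (act_AA HM) // addNr (act_t0 HM).
  by apply/eqP; rewrite -uE tu0; apply: (linear0 (act_lin HM (SA (- k) false))).
apply: (isomorphic_Gamma HM fam _ simpleM) => // k _.
exact: (par_act_A HM false (erefl : predT k) par_u).
Qed.

Lemma polynomial_classification M :
    is_jet (gsub F pgplus) (Asub F paplus) M ->
    simple (semidirect (gsub F pgplus) (Asub F paplus)) M ->
  (exists lam b : F, (forall m : int, lam != m%:~R) /\
     isomorphic (semidirect (gsub F pgplus) (Asub F paplus)) M (Gamma lam b)) \/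
  (exists b : F,
     isomorphic (semidirect (gsub F pgplus) (Asub F paplus)) M (Gamma_plus b)) \/
  (exists b : F,
     isomorphic (semidirect (gsub F pgplus) (Asub F paplus)) M (Gamma_minus b)).
Proof.
move=> [HM _ [lam0 [v nz_v wt_v] fin]] simpleM; pose C := contact_of HM.
have lam0_spanned : fin_spanned (fun w : M => op_L0 C w = lam0 *: w) by apply: fin.
have lam0_weight : exists2 w : M, w != 0 & op_L0 C w = lam0 *: w by exists v.
have [rs h_bounded] := plus_h_bounded HM simpleM lam0_spanned lam0_weight.
have [lam [b [j [u0 [nz_u0 den_u0 wtE top]]]]] :=
  density_vector_exists lam0_spanned lam0_weight h_bounded.
have [q [u [nz_u par_u den_u]]] := homogeneous_density nz_u0 den_u0.
have mod_M : is_module (semidirect (gsub F pgplus) (Asub F paplus)) M by have [] := HM.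
pose K (w : M) : Prop := w \in par q.
have K_t w : K w -> K (op_t C w) by move=> Kw; have := par_act_A HM false (isT : paplus 1) Kw.
have K_Lm w : K w -> K (op_Lm C w) by move=> Kw; have := par_act_L HM (isT : pgplus (-1)) Kw.
have K_Z c w : K w -> K (c *: w).
  have [par0 par_lin] := par_submod mod_M q.
  by move=> Kw; rewrite -[_ *: _]addr0; apply: par_lin.
have [[m lamE]|lam_nint] := pselect (exists m : int, lam = m%:~R); last first.
  left; exists lam, b.
  have lam_neq (m : int) : lam != m%:~R by apply/eqP => lamE; apply: lam_nint; exists m.
  split=> //.
  have [x [str x0 nz_x]] := weyl_string_exists K_t K_Lm K_Z nz_u par_u den_u (fun n => lam_neq n).
  have fam : density_family pgplus paplus predT lam b x.
    apply: string_density_family => //; first by left.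
    by move=> k _; have [_ ? ? ?] := str k.
  apply: (isomorphic_Gamma HM fam _ simpleM (q := q)) => //.
    by move=> k _; have [] := str k.
  case=> n; last by rewrite NegzE.
  elim: n => [|n IH]; first exact: (nz_x 0%N).
  apply: contraNneq IH => x_n.
  have [_ _ _] := str n.+1; rewrite x_n linear0 => /esym/eqP.
  rewrite scaler_eq0 (_ : n.+1%:Z - 1 = n); last lia.
  case/orP => //; rewrite addr_eq0 -rmorphN => /eqP lamE.
  by case/eqP: (lam_neq (- n.+1%:Z)).
(* An integral exponent is moved along the string to [0] or [-1]. *)
right; rewrite lamE in den_u.
have [[w [nz_w Kw den_w Lm_w]]|[w [nz_w Kw den_w t_w]]] :=
  density_integral_exponent K_t K_Lm nz_u par_u den_u.
- left; exists b.
  pose x (k : int) : M := if k is Posz n then iter n (op_t C) w else 0.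
  have str n : [/\ K (x (Posz n)), density C (0 + n%:Z%:~R) b (x (Posz n))
      & op_Lm C (x (Posz n)) = (0 + n%:Z%:~R) *: x (Posz n - 1)].
    elim: n => [|n [Kx den_x Lm_x]]; first by rewrite addr0 scale0r.
    split; first exact: K_t.
      by rewrite intS rmorphD /= (addrC 1) addrA; apply: density_t.
    rewrite (_ : n.+1%:Z - 1 = n); last lia.
    have [_ tLm_x _ _ _] := den_x.
    rewrite [x (Posz n.+1)](_ : _ = op_t C (x (Posz n))) // op_Lm_t tLm_x.
    by rewrite intS rmorphD /=; lmod.
  have nz_x n : x (Posz n) != 0.
    elim: n => [//|n]; apply: contraNneq => x_n.
    have [_ _] := str n.+1; rewrite x_n linear0 => /esym/eqP.
    rewrite scaler_eq0 (_ : n.+1%:Z - 1 = n); last lia.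
    by rewrite add0r intr_eq0.
  have fam : density_family pgplus paplus paplus 0 b x.
    apply: string_density_family.
    - by move=> k l; rewrite /paplus; lia.
    - move=> k k0; have [->|nz_k] := eqVneq k 0; [by right; rewrite addr0|left].
      by move: k0 nz_k; rewrite /paplus; lia.
    - case=> // n _; have [_ den_x Lm_x] := str n; split=> //.
      by rewrite -PoszD addn1.
  apply: (isomorphic_Gamma_plus HM simpleM fam (q := q)) => k.
    by case: k => // n _; have [] := str n.
  by case: k => // n _; have := nz_x n.
- right; exists b.
  have neg1 (n : nat) : -1 != n%:R :> F.
    by rewrite eq_sym -addr_eq0 natr1 pnatr_eq0.
  have [z [str z0 nz_z]] := weyl_string_exists K_t K_Lm K_Z nz_w Kw den_w neg1.
  (* The string starts at the exponent [-1] and dies above it. *)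
  pose x k := z (k + 1).
  have fam : density_family pgplus paplus predT 0 b x.
    apply: string_density_family => //; first by left.
    move=> k _; have [_ den_z t_z Lm_z] := str (k + 1); rewrite /x.
    have expE : 0 + k%:~R = -1 + (k + 1)%:~R :> F by rewrite rmorphD /= addrCA addNr addr0 add0r.
    by rewrite expE; split; [exact: den_z | exact: t_z | rewrite Lm_z addrK subrK].
  have z_up (n : nat) : z n.+1 = 0.
    elim: n => [|n IH]; first by have [_ _ <- _] := str 0; rewrite z0.
    by have [_ _] := str n.+1; rewrite -PoszD addn1 => <- _; rewrite IH linear0.
  apply: (isomorphic_Gamma_minus HM simpleM fam (q := q)).
  + by move=> k; have [] := str (k + 1).
  + by case=> // n _; rewrite /x -PoszD addn1.
  + case=> // n _; rewrite /x (_ : Negz n + 1 = - n%:Z); first exact: nz_z.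
    by lia.
Qed.

End Classification.

Local Open Scope complex_scope.

Theorem theorem3p10 (R : realType) :
  (forall M : superrep R[i],
     is_jet kfull Afull M -> simple (semidirect kfull Afull) M ->
     exists lam b : R[i],
       isomorphic (semidirect kfull Afull) M (Gamma lam b)) /\
  (forall M : superrep R[i],
     is_jet kplus Afull M -> simple (semidirect kplus Afull) M ->
     exists lam b : R[i],
       isomorphic (semidirect kplus Afull) M (Gamma lam b)) /\
  (forall M : superrep R[i],
     is_jet kplus Aplus M -> simple (semidirect kplus Aplus) M ->
     (exists lam b : R[i], (forall m : int, lam != m%:~R) /\
        isomorphic (semidirect kplus Aplus) M (Gamma lam b)) \/
     (exists b : R[i],
        isomorphic (semidirect kplus Aplus) M (Gamma_plus b)) \/
     (exists b : R[i],
        isomorphic (semidirect kplus Aplus) M (Gamma_minus b))).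
Proof.
rewrite kfullE AfullE; split; last split.
- by move=> M; apply: invertible_classification => //; right.
- by move=> M; apply: (@invertible_classification _ pgplus) => //; left.
- by move=> M; apply: polynomial_classification.
Qed.
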